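(* Fix an integer $g\ge2$. Let $I_g\subset\mathbb Q[x_1,x_2,\ldots]$ be the linear span of all homogeneous polynomials of degree $>g$ (with respect to the grading $\deg x_i=i$) and of all polynomials of the form $D^d(x_1^{m_1}\cdots x_k^{m_k})$, where $d\ge0$, $m_1+2m_2+\ldots+km_k=g$, $m_1<g$, and $D$ is the differential operator defined in the context. Let $R^{\mathrm{Jac}}_g=\mathbb Q[x_1,x_2,\ldots]/I_g$ and let $p_i$ denote the image of $x_i$ in $R^{\mathrm{Jac}}_g$. Then: (i) $I_g=\bigcap_{n\ge1}\mathrm{im}(D^n)$, where $\mathrm{im}(D^n)$ is the image of $D^n$ acting on $\mathbb Q[x_1,x_2,\ldots]$. (ii) $I_g$ is an ideal in $\mathbb Q[x_1,x_2,\ldots]$, so $R^{\mathrm{Jac}}_g$ has a commutative ring structure. (iii) The formula $$(-1)^nS(p_1^{[n]}p_{n_1}\cdots p_{n_k})=\sum_{[1,k]=I_1\sqcup\ldots\sqcup I_m}b(I_1)\cdots b(I_m)\,p_1^{[g-n-m-\sum_{i=1}^k n_i]}\,p_{d(I_1)}\cdots p_{d(I_m)}\qquad(k\ge 0,\ n\ge0,\ n_i>1)$$ gives a well-defined linear operator $S$ on $R^{\mathrm{Jac}}_g$ (that is, the operator on $\mathbb Q[x_1,x_2,\ldots]$ defined on monomials by this formula with $x_i$ in place of $p_i$ maps $I_g$ to $I_g$), and $$S^2(p_1^np_{n_1}\cdots p_{n_k})=(-1)^{g+k+\sum_{i=1}^k n_i}\,p_1^np_{n_1}\cdots p_{n_k}$$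 for $n\ge 0$ and $n_i>1$. (iv) The operators $$e(F)=x_1\cdot F,\qquad f=-D,\qquad h=-g+\sum_{n\ge1}(n+1)x_n\partial_n$$ on $\mathbb Q[x_1,x_2,\ldots]$ define a representation of the Lie algebra $\mathfrak{sl}_2$. They preserve $I_g$ and therefore define a representation of $\mathfrak{sl}_2$ on $R^{\mathrm{Jac}}_g$. The operators $S,e,f,h$ on $R^{\mathrm{Jac}}_g$ satisfy $$SeS^{-1}=-f,\qquad SfS^{-1}=-e,\qquad ShS^{-1}=-h.$$
   Context: $D=-g\,\partial_1+\frac12\sum_{m,n\ge 1}\binom{m+n}{m}x_{m+n-1}\partial_m\partial_n$ with $\partial_i=\partial/\partial x_i$, acting on $\mathbb Q[x_1,x_2,\ldots]$. Divided powers: $y^{[d]}=y^d/d!$ for $d\ge0$ and $y^{[d]}=0$ for $d<0$. In (iii) the sum is over all partitions of $[1,k]=\{1,\ldots,k\}$ into a disjoint union of nonempty subsets $I_1,\ldots,I_m$; partitions differing only by the ordering of the parts are identified; for $k=0$ there is only the empty partition with $m=0$. For a nonempty subset $I=\{i_1,\ldots,i_s\}\subset[1,k]$: $b(I)=\dfrac{(n_{i_1}+\ldots+n_{i_s})!}{n_{i_1}!\cdots n_{i_s}!}$ and $d(I)=n_{i_1}+\ldots+n_{i_s}-s+1$. The $\mathfrak{sl}_2$ relations are $[e,f]=h$, $[h,e]=2e$, $[h,f]=-2f$. *)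

(* Defs.v *)
From HB Require Import structures.
From mathcomp Require Import all_boot all_order all_algebra.
From mathcomp Require Import generic_quotient ring_quotient.
From mathcomp Require Import finmap.
From mathcomp Require Import boolp classical_sets functions cardinality fsbigop.
From mathcomp Require Import monalg.

Set Implicit Arguments.
Unset Strict Implicit.
Unset Printing Implicit Defensive.

Import GRing.Theory.

Local Open Scope classical_set_scope.
Local Open Scope quotient_scope.
Local Open Scope ring_scope.

Section LinearSpan.
Variables (K : nzRingType) (V : lmodType K).

Definition lspan (A : set V) : set V :=
  [set v | exists s : seq (K * V),
     (forall c, c \in s -> A c.2) /\ v = \sum_(c <- s) c.1 *: c.2].

Variable A : set V.

Definition in_lspan : {pred V} := fun v => `[< lspan A v >].

Lemma lspan0 : lspan A 0.
Proof. by exists [::]; split=> //; rewrite big_nil. Qed.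

Lemma lspanD u v : lspan A u -> lspan A v -> lspan A (u + v).
Proof.
move=> [s [sA ->]] [t [tA ->]]; exists (s ++ t); split; last by rewrite big_cat.
by move=> c; rewrite mem_cat => /orP[/sA|/tA].
Qed.

Lemma lspanZ a v : lspan A v -> lspan A (a *: v).
Proof.
move=> [s [sA ->]]; exists [seq (a * c.1, c.2) | c <- s]; split.
  by move=> c /mapP[d /sA Ad ->].
by rewrite big_map scaler_sumr; apply: eq_bigr => c _; rewrite scalerA.
Qed.

Lemma in_lspan_zmod_closed : zmod_closed in_lspan.
Proof.
split=> [|u v /asboolP Au /asboolP Av]; apply/asboolP; first exact: lspan0.
by apply: lspanD => //; rewrite -scaleN1r; exact: lspanZ.
Qed.

HB.instance Definition _ :=
  GRing.isZmodClosed.Build V in_lspan in_lspan_zmod_closed.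

Definition lquot := Quotient.quot in_lspan.

HB.instance Definition _ := Choice.on lquot.
HB.instance Definition _ := GRing.Zmodule.on lquot.
HB.instance Definition _ : EqQuotient V (Quotient.equiv in_lspan) lquot :=
  EqQuotient.on lquot.

Lemma lquot_eqP u v : \pi_lquot u = \pi_lquot v <-> lspan A (u - v).
Proof.
split=> [/eqP|Auv]; last apply/eqP; rewrite -(Quotient.idealrBE in_lspan).
  by move=> /asboolP.
exact/asboolP.
Qed.

Lemma lquot_piD u v : \pi_lquot (u + v) = \pi_lquot u + \pi_lquot v.
Proof. exact: (raddfD (\pi_(Quotient.quot in_lspan))). Qed.

Definition lquot_scale (a : K) : lquot -> lquot := lift_op1 lquot ( *:%R a).

Lemma lquot_piZ a u : \pi_lquot (a *: u) = lquot_scale a (\pi_lquot u).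
Proof.
rewrite /lquot_scale; unlock; apply/lquot_eqP; rewrite -scalerBr.
by apply/lspanZ/lquot_eqP; rewrite reprK.
Qed.

Lemma lquot_scaleA a b (u : lquot) :
  lquot_scale a (lquot_scale b u) = lquot_scale (a * b) u.
Proof. by rewrite -[u]reprK -!lquot_piZ scalerA. Qed.

Lemma lquot_scale1 : left_id 1 lquot_scale.
Proof. by move=> u; rewrite -[u]reprK -lquot_piZ scale1r. Qed.

Lemma lquot_scaleDr : right_distributive lquot_scale +%R.
Proof.
move=> a u v; rewrite -[u]reprK -[v]reprK -lquot_piD -!lquot_piZ.
by rewrite scalerDr lquot_piD.
Qed.

Lemma lquot_scaleDl (u : lquot) :
  {morph lquot_scale^~ u : a b / a + b}.
Proof. by move=> a b; rewrite -[u]reprK -!lquot_piZ scalerDl lquot_piD. Qed.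

HB.instance Definition _ := GRing.Zmodule_isLmodule.Build K lquot
  lquot_scaleA lquot_scale1 lquot_scaleDr lquot_scaleDl.

End LinearSpan.

(* The polynomial ring Q[x_1, x_2, ...]: the monomial algebra on commutative  *)
(* monomials indexed by nat.  The generator of index j of the monomial type   *)
(* stands for x_{j+1}, whence the i.-1 in 'x_i and pderiv, which are only    *)
(* meaningful (and only used) for i >= 1.                                     *)
Notation Qx := {malg rat[{cmonom nat}]}.

Definition xvar (i : nat) : Qx := << ucm i.-1 >>.

Notation "''x_' i" := (xvar i)
  (at level 8, i at level 2, format "''x_' i") : ring_scope.

Definition pderiv (i : nat) (F : Qx) : Qx :=
  \sum_(m <- msupp F) << F@_m *+ m i.-1 *g divcm m (ucm i.-1) >>.

(* Weight of a monomial for the grading deg x_i = i. *)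
Definition wdeg (m : {cmonom nat}) : nat := (\sum_(j <- finsupp m) m j * j.+1)%N.

Definition whomog (d : nat) : set Qx :=
  [set F : Qx | forall m, m \in msupp F -> wdeg m = d].

(* The sums over all m, n >= 1 (resp. n >= 1) are finitely supported sums:    *)
(* for a given F only finitely many terms are nonzero.                        *)
Definition opD (g : nat) (F : Qx) : Qx :=
  - (g%:R *: pderiv 1 F)
  + 2%:R^-1 *: \sum_(mn \in [set mn : nat * nat | (1 <= mn.1)%N /\ (1 <= mn.2)%N])
      'C(mn.1 + mn.2, mn.1)%:R *:
        ('x_(mn.1 + mn.2 - 1) * pderiv mn.1 (pderiv mn.2 F)).

Definition op_e (F : Qx) : Qx := 'x_1 * F.

Definition op_f (g : nat) (F : Qx) : Qx := - opD g F.

Definition op_h (g : nat) (F : Qx) : Qx :=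
  - (g%:R *: F)
  + \sum_(n \in [set n : nat | (1 <= n)%N]) n.+1%:R *: ('x_n * pderiv n F).

Definition Ig_gens (g : nat) : set Qx :=
  [set F : Qx | exists2 d, (g < d)%N & whomog d F]
  `|` [set F : Qx | exists (d k : nat) (m : nat -> nat),
        [/\ (\sum_(1 <= i < k.+1) i * m i)%N = g, (m 1 < g)%N &
            F = iter d (opD g) (\prod_(1 <= i < k.+1) 'x_i ^+ m i)]].

Definition Ig (g : nat) : set Qx := lspan (Ig_gens g).

Notation RJac g := (lquot (Ig_gens g)).

Definition divpow (y : Qx) (d : int) : Qx :=
  if d is Posz n then n`!%:R^-1 *: y ^+ n else 0.

Section SetPartitionFormula.
Variables (k : nat) (ns : 'I_k -> nat).

Definition bcoef (I : {set 'I_k}) : rat :=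
  (\sum_(i in I) ns i)`!%:R / \prod_(i in I) (ns i)`!%:R.

(* Used for nonempty I with all ns i > 1, so the subtraction is not truncated. *)
Definition dcoef (I : {set 'I_k}) : nat := (\sum_(i in I) ns i - #|I| + 1)%N.

Definition Srhs (g n : nat) : Qx :=
  \sum_(P : {set {set 'I_k}} | finset.partition P [set: 'I_k]%SET)
    (\prod_(I in P) bcoef I) *:
      (divpow 'x_1 (g%:Z - n%:Z - #|P|%:Z - (\sum_i ns i)%N%:Z)
       * \prod_(I in P) 'x_(dcoef I)).

End SetPartitionFormula.

Definition is_ideal (I : set Qx) : Prop :=
  [/\ I 0, (forall F G, I F -> I G -> I (F + G))
    & forall F G, I G -> I (F * G)].

Section Operators.
Variable V : lmodType rat.
Implicit Types e f h : V -> V.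

Definition lie_bracket (a b : V -> V) (v : V) : V := a (b v) - b (a v).

Definition sl2_rep e f h : Prop :=
  [/\ linear e, linear f & linear h] /\
  [/\ forall v, lie_bracket e f v = h v,
      forall v, lie_bracket h e v = 2%:R *: e v
    & forall v, lie_bracket h f v = - 2%:R *: f v].

End Operators.

Definition preserves (I : set Qx) (T : Qx -> Qx) : Prop :=
  forall F, I F -> I (T F).

Definition induces (g : nat) (T : Qx -> Qx) (T' : RJac g -> RJac g) : Prop :=
  forall F, T' (\pi_(RJac g) F) = \pi_(RJac g) (T F).

(* Main.v *)
(** Put e = x_1, f = -D and h = [e, f]; they span an sl2 on Q[x_1, x_2, ...].
    For an h-eigenvector y of eigenvalue l set
      P_a(y) = sum_r x_1^[a+r] D^r y / r!     (a an integer).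
    Then D P_a(y) = (a - 1 + l) P_{a-1}(y), so P_a(y) lies in every im(D^n) as
    soon as a + l >= 1, while x_1^[n] y = sum_r (-1)^r P_{n+r}(D^r y) / r!.
    If y is a monomial of degree d in k variables, none of them x_1, then
    l = d + k - g and D^r y = 0 for r > k, or r = k > 0; this puts every monomial
    of degree > g, and every monomial of degree g other than x_1^g, in the
    intersection J of the images, and a degree count gives J = I_g.

    J is an ideal because (ad D)^(n+2) (x_n) = 0: the operators (ad D)^i (x_n)
    satisfy the commutation relations of the p^i q^(n+1-i) for the Poisson
    bracket, D playing the role of p^2/2.

    In these terms S(x_1^[n] y) = (-1)^n P_{-l-n}(y) for y free of x_1, whence
    S e = D S, S h = - h S, S D = e S modulo J and S^2 = +-1 modulo J.  The sum
    over set partitions is P_{-l-n}(y), because D^r y / r! is the sum over the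
    partitions into k - r blocks; this is an induction on the number of
    variables, the identity needed at each step being of Hurwitz-Abel type. *)
Require Import Defs.
From HB Require Import structures.
From mathcomp Require Import all_boot all_order all_algebra.
From mathcomp Require Import ring lra zify.

Set Implicit Arguments.
Unset Strict Implicit.
Unset Printing Implicit Defensive.

Import GRing.Theory.

(** * A Hurwitz-Abel identity and sums over set partitions *)

(** Two principles carry the computations. Since D has order two, [D, x_m] has order one and
    [[D, x_m], x_n] is multiplication by binomial(m+n, m) x_(m+n-1). An operator that kills 1 and
    commutes with all variables is zero, so an identity between operators is checked on the constant
    1 and on brackets with the variables; the relations among the (ad D)^i (x_n) thus reduce to
    identities between factorials.

    On a product of variables other than x_1, D merges two factors x_a, x_b into binomial(a+b, a)
    x_(a+b-1). In a sum over set partitions a block L therefore arises from every splitting of L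
    into two blocks I and J. The multinomials b(I), b(J) and the binomial of D collapse to falling
    factorials of lengths |I| - 1 and |J| - 1, up to a factor depending on L only, and the total
    must be (|L| - 1) b(L): this is where the Hurwitz-Abel identity comes from. Requiring a fixed
    point x0 of L to lie in I counts each unordered splitting once, which matches the factor 1/2 in
    D. *)

Lemma ffactSn n m : n.+1 ^_ m.+1 = n ^_ m.+1 + m.+1 * n ^_ m.
Proof.
rewrite ffactSS ffactnSr -[n.+1]addn1.
have [mn|nm] := leqP m n; last by rewrite ffact_small // !muln0.
by rewrite [_ * (n - m)]mulnC -mulnDl -[m.+1]addn1 addnA subnK.
Qed.

Section HurwitzAbel.
Variables (T : finType) (n : T -> nat).
Hypothesis n_gt0 : forall i, 0 < n i.
Implicit Types (K I J L : {set T}).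

Local Notation N K := (\sum_(i in K) n i).

(** The falling factorial analogue of Abel's x (x + N)^(|J| - 1): it equals x / (x + N J) times
    [(x + N J) ^_ #|J|], with the division carried out so that x = 0 is allowed and gives 0 for
    nonempty J. *)
Definition abel J x := if #|J| is j.+1 then x * (x + N J).-1 ^_ j else 1.

Lemma sumD1 K l : l \in K -> N K = n l + N (K :\ l).
Proof. by move=> lK; rewrite (big_setD1 l). Qed.

(** Since x + n l + N (J :\ l) = x + N J, when J has at least two elements all summands share one
    falling factorial, and the sum over l only adds up the factors x + n l. *)
Lemma abelS J x : abel J x.+1 = abel J x + \sum_(l in J) abel (J :\ l) (x + n l).
Proof.
have [J0|[l0 l0J]] := set_0Vmem J.
  by rewrite J0 /abel cards0 big_set0.
have [j jE] : exists j, #|J| = j.+1 by rewrite (cardsD1 l0) l0J; eexists.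
have cJ l : l \in J -> #|J :\ l| = j.
  by move=> lJ; move: jE; rewrite (cardsD1 l) lJ => -[].
case: j jE cJ => [|j] jE cJ.
  rewrite {1 2}/abel jE !ffactn0 !muln1.
  have /eqP/cards1P[l JE] : #|J| = 1 by [].
  by rewrite JE big_set1 /abel setDv cards0 addn1.
have NJ : 0 < N J by rewrite (sumD1 l0J) addn_gt0 n_gt0.
have -> : \sum_(l in J) abel (J :\ l) (x + n l) = (j.+2 * x + N J) * (x + N J).-1 ^_ j.
  transitivity (\sum_(l in J) (x + n l) * (x + N J).-1 ^_ j).
    by apply: eq_bigr => l lJ; rewrite /abel cJ // -addnA -sumD1.
  by rewrite -big_distrl /= big_split /= sum_nat_const jE.
rewrite /abel jE; case: (N J) NJ => // M _; rewrite !addnS !addSn /=.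
rewrite ffactSS ffactnSr.
have [jM|Mj] := leqP j (x + M); last by rewrite ffact_small // !(muln0, mul0n).
move: ((x + M) ^_ j) => t; rewrite -{1}(subnK jM).
have := subnK jM; move: (x + M - j) => r rE; nia.
Qed.

(** At x = 0 only the empty J contributes. Both sides then have the same forward difference in x: on
    the left [abelS] and an exchange of sums give instances for the sets K :\ l with x + n l in
    place of x, on the right the rule is [ffactSn]. *)
Lemma hurwitz K x y :
  \sum_(J : {set T} | J \subset K) abel J x * (y + N (K :\: J)) ^_ #|K :\: J|
  = (x + y + N K) ^_ #|K|.
Proof.
have [k] := ubnP #|K|; elim: k => // k IHk in K x y *; rewrite ltnS => Kk.
elim: x => [|x IHx].
  rewrite (bigD1 set0) ?sub0set //= setD0 /abel cards0 mul1n [X in _ + X]big1 ?addn0 ?add0n //.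
  by move=> J /andP[_]; rewrite -cards_eq0; case: #|J|.
have -> : \sum_(J : {set T} | J \subset K) abel J x.+1 * (y + N (K :\: J)) ^_ #|K :\: J|
  = (x + y + N K) ^_ #|K| + \sum_(l in K) (x + y + N K) ^_ #|K|.-1.
  rewrite -IHx.
  transitivity (\sum_(J : {set T} | J \subset K)
      (abel J x * (y + N (K :\: J)) ^_ #|K :\: J|
       + \sum_(l in J) abel (J :\ l) (x + n l) * (y + N (K :\: J)) ^_ #|K :\: J|)).
    by apply: eq_bigr => J _; rewrite abelS mulnDl big_distrl.
  rewrite big_split /=; congr (_ + _).
  rewrite (exchange_big_dep (mem K)) /=; last by move=> J l JK; exact: (subsetP JK).
  apply: eq_bigr => l lK.
  have lKk : #|K :\ l| < k by move: Kk; rewrite (cardsD1 l) lK add1n.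
  have -> : #|K|.-1 = #|K :\ l| by rewrite (cardsD1 l K) lK.
  rewrite (sumD1 lK) (_ : x + y + (n l + N (K :\ l)) = x + n l + y + N (K :\ l)); last by lia.
  rewrite -(IHk _ _ _ lKk).
  rewrite (reindex_onto (fun J => l |: J) (fun J => J :\ l)) /=; last first.
    by move=> J /andP[_ lJ]; rewrite setD1K.
  have setU1_inv J : ((l |: J) :\ l == J) = (l \notin J).
    by apply/eqP/idP => [<-|/setU1K//]; rewrite setD11.
  apply: eq_big => J.
    by rewrite setU11 andbT subUset sub1set lK /= subsetD1 setU1_inv.
  by case/andP => _ /eqP ->; rewrite setDDl.
rewrite sum_nat_const; case: #|K| => [|j]; first by rewrite mul0n.
by rewrite !addSn ffactSn.
Qed.

(** This is [hurwitz] for K :\ x0 with x = 1 and y = n x0, read through J = K :\: I, since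
    [abel J 1] is [N J ^_ #|J|.-1] for nonempty J. The term of the empty J is moved to the other
    side, where [ffactSn] turns the difference into the stated product. *)
Lemma ffact_split K (x0 : T) : x0 \in K ->
  \sum_(I : {set T} | [&& I \subset K, x0 \in I & I != K])
    N I ^_ #|I|.-1 * N (K :\: I) ^_ #|K :\: I|.-1
  = #|K|.-1 * N K ^_ #|K|.-2.
Proof.
move=> x0K; have kE : #|K|.-1 = #|K :\ x0| by rewrite (cardsD1 x0) x0K.
have := hurwitz (K :\ x0) 1 (n x0).
rewrite (bigD1 set0) ?sub0set //= setD0 {1}/abel cards0 mul1n.
rewrite add1n addSn -(sumD1 x0K).
rewrite -kE (reindex_onto (fun I => K :\: I) (fun J => K :\: J)) /=; last first.
  move=> J /andP[/subsetD1P[JK _] _].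
  by rewrite setDDr setDv set0U; apply/setIidPr.
rewrite (eq_bigl (fun I : {set T} => [&& I \subset K, x0 \in I & I != K])); last first.
  move=> I; rewrite -cards_eq0 cards_eq0 setD_eq0 subsetD1 subsetDl !inE x0K andbT negbK /=.
  rewrite setDDr setDv set0U (sameP eqP setIidPr).
  have [IK|_] := boolP (I \subset K); last by rewrite andbF.
  by rewrite andbT eqEsubset IK.
rewrite (eq_bigr (fun I : {set T} => N I ^_ #|I|.-1 * N (K :\: I) ^_ #|K :\: I|.-1)).
  case: #|K|.-1 => [|k]; first by rewrite !ffactn0 -[X in _ = X -> _]addn0 => /addnI.
  by rewrite ffactSn => /addnI.
move=> I /and3P[IK x0I IK'].
have -> : K :\ x0 :\: (K :\: I) = I :\ x0.
  apply/setP => i; rewrite !inE.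
  case: (boolP (i \in I)) => [/(subsetP IK)->|_]; rewrite ?andbF ?andbT //=.
  by case: (i \in K); rewrite ?andbF.
rewrite -(sumD1 x0I) [LHS]mulnC; congr (_ ^_ _ * _).
  by rewrite (cardsD1 x0 I) x0I.
rewrite /abel; have : K :\: I != set0.
  by rewrite setD_eq0; apply: contra IK' => KI; rewrite eqEsubset IK.
by rewrite -cards_eq0; case: #|K :\: I| => // j _; rewrite mul1n add1n.
Qed.
End HurwitzAbel.

Local Open Scope ring_scope.

Definition facR n : rat := n`!%:R.

Lemma facR_neq0 n : facR n != 0.
Proof. by rewrite Num.Theory.pnatr_eq0 -lt0n fact_gt0. Qed.

Lemma facRS n : facR n.+1 = (n%:R + 1) * facR n.
Proof. by rewrite /facR factS natrM -natr1. Qed.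

Lemma natr1_neq0 n : n%:R + 1 != 0 :> rat.
Proof. by rewrite natr1 Num.Theory.pnatr_eq0. Qed.

Lemma bin_facR m r : 'C(m + r, m)%:R = facR (m + r) / (facR m * facR r) :> rat.
Proof.
apply: (mulIf (mulf_neq0 (facR_neq0 m) (facR_neq0 r))).
rewrite mulfVK ?mulf_neq0 ?facR_neq0 //.
by rewrite /facR -!natrM -(bin_fact (leq_addr r m)) addKn.
Qed.

(** * Weighted sums over the partitions of a set into a given number of blocks *)

Section PartitionSums.
Variables (T : finType) (R : comPzRingType).
Implicit Types (J K L : {set T}) (P Q : {set {set T}}).

Lemma partition_block_reindex J K M (f : {set {set T}} -> R) :
  J != set0 -> J \subset K ->
  \sum_(P : {set {set T}} | [&& partition P K, #|P| == M.+1 & J \in P]) f (P :\ J)%SET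
  = \sum_(Q : {set {set T}} | partition Q (K :\: J)%SET && (#|Q| == M)) f Q.
Proof.
move=> J0 JK.
rewrite (reindex_onto (fun Q => J |: Q)%SET (fun P => P :\ J)%SET) /=; last first.
  by move=> P /and3P[_ _ JP]; rewrite setD1K.
have JQ Q : partition Q (K :\: J)%SET -> J \notin Q.
  move=> QP; apply/negP => JinQ; have := partitionS QP JinQ.
  by rewrite subsetD -setI_eq0 setIid (negPf J0) andbF.
have U1K Q : ((J |: Q) :\ J == Q)%SET = (J \notin Q).
  by apply/eqP/idP => [<-|/setU1K//]; rewrite setD11.
apply: eq_big => [Q|Q /andP[_ /eqP->]] //; rewrite U1K setU11 andbT.
apply/andP/andP => [[/andP[P1 P2] nJ]|[Q1 Q2]].
  split; first by have := partitionD1 P1 (setU11 _ _); rewrite setU1K.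
  by move: P2; rewrite cardsU1 nJ add1n.
rewrite (JQ _ Q1) cardsU1 (JQ _ Q1) add1n eqSS Q2 andbT; split=> //.
have JU : J :|: K :\: J = K by rewrite -{1}(setIidPr JK) setID.
have := partitionU1 Q1 J0; rewrite JU.
by apply; rewrite -setI_eq0 setIC setIDAC -setIDA setDv setI0.
Qed.

Variable w : {set T} -> R.

(** A partial Bell polynomial in the block weights w. *)
Definition part_sum (M : nat) K : R :=
  \sum_(P : {set {set T}} | partition P K && (#|P| == M)) \prod_(I in P) w I.

(** Double counting of pairs made of a partition and a marked block. It is used with c J meaning x0
    in J, where exactly one block can be marked, and with c always true, which is the Leibniz
    rule. *)
Lemma part_sum_pointed (c : pred {set T}) (u : {set T} -> R) M K :
  \sum_(P : {set {set T}} | partition P K && (#|P| == M.+1))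
     \sum_(J in P | c J) u J * \prod_(I in (P :\ J)%SET) w I
  = \sum_(J : {set T} | [&& J \subset K, J != set0 & c J])
     u J * part_sum M (K :\: J)%SET.
Proof.
rewrite (exchange_big_dep (fun J => [&& J \subset K, J != set0 & c J])) /=.
  apply: eq_bigr => J /and3P[JK J0 cJ]; rewrite /part_sum mulr_sumr.
  rewrite -(@partition_block_reindex J K M (fun Q => u J * \prod_(I in Q) w I)) //.
  by apply: eq_bigl => P; rewrite cJ andbT andbA.
move=> P J /andP[PK _] /andP[JP ->].
by rewrite (partitionS PK) // (partition_neq0 PK).
Qed.

Lemma part_sum_rec x0 M K : x0 \in K ->
  part_sum M.+1 K =
  \sum_(J : {set T} | [&& J \subset K, J != set0 & x0 \in J])
     w J * part_sum M (K :\: J)%SET.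
Proof.
move=> x0K; rewrite -(part_sum_pointed (fun J => x0 \in J)); apply: eq_bigr => P /andP[PK _].
have cP := cover_partition PK; have tP := partition_trivIset PK.
have xP : x0 \in cover P by rewrite cP.
rewrite [RHS](big_pred1 (pblock P x0)) => [|J /=].
  by rewrite (big_setD1 (pblock P x0)) ?pblock_mem.
apply/andP/eqP => [[JP xJ]|->]; first by rewrite (def_pblock tP JP).
by rewrite pblock_mem ?mem_pblock.
Qed.

Lemma part_sum0 K : part_sum 0 K = (K == set0)%:R.
Proof.
rewrite /part_sum; case: eqVneq => [->|K0].
  rewrite (big_pred1 set0) ?big_set0 // => P /=.
  by rewrite partition_set0 cards_eq0 andbb.
rewrite big_pred0 // => P; apply/andP => -[PK]; rewrite cards_eq0 => /eqP P0.
by move: (cover_partition PK) K0; rewrite P0 /cover big_set0 => <-; rewrite eqxx.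
Qed.

Lemma part_sum_set0 M : part_sum M.+1 set0 = 0.
Proof.
rewrite /part_sum big_pred0 // => P; rewrite partition_set0.
by case: eqVneq => // ->; rewrite cards0.
Qed.

Lemma derivation_prod (d : R -> R) P :
  {morph d : a b / a + b} -> (forall a b, d (a * b) = d a * b + a * d b) -> d 1 = 0 ->
  d (\prod_(I in P) w I) = \sum_(J in P) d (w J) * \prod_(I in (P :\ J)%SET) w I.
Proof.
move=> dD dM d1; have [n] := ubnP #|P|; elim: n => // n IH in P *.
have [->|[J0 JP]] := set_0Vmem P; first by rewrite !big_set0.
rewrite (cardsD1 J0) JP add1n ltnS => Pn.
rewrite (big_setD1 J0) //= dM IH // [RHS](big_setD1 J0) //=; congr (_ + _).
rewrite mulr_sumr; apply: eq_bigr => J; rewrite !inE => /andP[JJ0 JP'].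
rewrite [in RHS](big_setD1 J0) ?inE ?JP 1?eq_sym ?JJ0 //= mulrCA; congr (_ * (_ * _)).
by apply: eq_bigl => I; rewrite !inE andbCA.
Qed.

Lemma part_sum_derivation (d : R -> R) M K :
  {morph d : a b / a + b} -> (forall a b, d (a * b) = d a * b + a * d b) ->
  d 0 = 0 -> d 1 = 0 ->
  d (part_sum M.+1 K) =
  \sum_(J : {set T} | (J \subset K) && (J != set0))
     d (w J) * part_sum M (K :\: J)%SET.
Proof.
move=> dD dM d0 d1; rewrite (big_morph d dD d0).
transitivity (\sum_(J : {set T} | [&& J \subset K, J != set0 & predT J])
     d (w J) * part_sum M (K :\: J)%SET); last first.
  by apply: eq_bigl => J; rewrite andbT.
rewrite -part_sum_pointed; apply: eq_bigr => P _; rewrite derivation_prod //.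
by apply: eq_bigl => J; rewrite andbT.
Qed.

Lemma card_partition_le P K : partition P K -> (#|P| <= #|K|)%N.
Proof.
move=> PK; rewrite (card_partition PK) -sum1_card; apply: leq_sum => I IP.
by rewrite card_gt0 (partition_neq0 PK).
Qed.

Lemma part_sum_gt M K : (#|K| < M)%N -> part_sum M K = 0.
Proof.
move=> KM; rewrite /part_sum big_pred0 // => P; apply/andP => -[PK /eqP PM].
by have := card_partition_le PK; rewrite PM leqNgt KM.
Qed.

Lemma part_sum_max K : part_sum #|K| K = \prod_(i in K) w [set i]%SET.
Proof.
have [n] := ubnP #|K|; elim: n => // n IH in K *.
have [->|[x0 xK]] := set_0Vmem K; first by rewrite cards0 part_sum0 eqxx big_set0.
have K1 : #|K| = #|(K :\ x0)%SET|.+1 by rewrite (cardsD1 x0) xK.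
rewrite K1 ltnS => Kn; rewrite (part_sum_rec _ xK) (bigD1 [set x0]%SET) /=; last first.
  by rewrite sub1set xK set11 andbT; apply/set0Pn; exists x0; rewrite set11.
rewrite IH // [RHS](big_setD1 x0) //= [X in _ + X]big1 ?addr0 // => J /andP[/and3P[JK _ xJ] Jx].
rewrite part_sum_gt ?mulr0 //.
rewrite cardsD (setIidPr JK) K1.
have : (1 < #|J|)%N.
  rewrite ltnNge; apply: contra Jx => J1; rewrite eq_sym eqEcard sub1set xJ cards1 //.
by have := subset_leq_card JK; rewrite K1; lia.
Qed.

(** The block I of x0 and a second block J are collected according to their union L; I then runs
    over the proper subsets of L containing x0. *)
Lemma part_sum_regroup x0 M K (G : {set T} -> {set T} -> R) :
  \sum_(I : {set T} | [&& I \subset K, I != set0 & x0 \in I])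
    \sum_(J : {set T} | (J \subset K :\: I) && (J != set0))
      G I J * part_sum M (K :\: I :\: J)
  = \sum_(L : {set T} | [&& L \subset K, L != set0 & x0 \in L])
      (\sum_(I : {set T} | [&& I \subset L, x0 \in I & I != L]) G I (L :\: I))
      * part_sum M (K :\: L).
Proof.
under [RHS]eq_bigr do rewrite mulr_suml.
rewrite [RHS](exchange_big_dep (fun I : {set T} => [&& I \subset K, I != set0 & x0 \in I])) /=; last first.
  move=> L I /and3P[LK _ _] /and3P[IL xI _]; rewrite xI (subset_trans IL LK) andbT /=.
  by apply/set0Pn; exists x0.
apply: eq_bigr => I /and3P[IK I0 xI].
rewrite [RHS](reindex_onto (fun J : {set T} => I :|: J) (fun L : {set T} => L :\: I)) /=; last first.
  move=> L /andP[_ /and3P[IL _ _]].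
  by rewrite -{1}(setIidPr IL) setID.
have UK J : ((I :|: J) :\: I == J) = [disjoint J & I].
  rewrite setDUl setDv set0U; apply/eqP/idP => [<-|/setDidPl//].
  by rewrite -setI_eq0 setIDAC -setIDA setDv setI0.
apply: eq_big => J.
  rewrite UK subsetD subUset IK subsetUl !inE xI /= andbT.
  have -> : I :|: J != set0 by apply/set0Pn; exists x0; rewrite inE xI.
  have [dJI|] := boolP [disjoint J & I]; last by rewrite !andbF.
  rewrite !andbT; congr (_ && ~~ _); apply/eqP/eqP => [->|IJ]; first by rewrite setU0.
  move: dJI; rewrite -setI_eq0 => /eqP; rewrite (setIidPl _) //.
  by rewrite IJ subsetUr.
case/andP; rewrite subsetD -UK => /andP[_ /eqP->] _.
by rewrite setDDl.
Qed.

(** Induction on K by splitting off the block I of x0. The term w I * D gives #|K| - #|I| - M by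
    induction; the derivation e I hits one further block J, and after regrouping by L = I :|: J the
    last hypothesis gives #|L| - 1. The sum #|K| - (M + 1) does not depend on L, so the recursion
    closes up again. *)
Lemma part_sum_flow (D : R -> R) (e : {set T} -> R -> R) M K :
  {morph D : a b / a + b} -> D 0 = 0 -> D 1 = 0 ->
  (forall I F, I != set0 -> D (w I * F) = w I * D F + e I F) ->
  (forall I, I != set0 -> [/\ {morph e I : a b / a + b}, 
     forall a b, e I (a * b) = e I a * b + a * e I b, e I 0 = 0 & e I 1 = 0]) ->
  (forall L x0, x0 \in L ->
     \sum_(I : {set T} | [&& I \subset L, x0 \in I & I != L]) e I (w (L :\: I))
     = (#|L|%:R - 1) * w L) ->
  D (part_sum M.+1 K) = (#|K|%:R - M%:R) * part_sum M K.
Proof.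
move=> DD D0 D1 Dw eP eL; have [n] := ubnP #|K|; elim: n => // n IH in K M *.
have [->|[x0 xK]] := set_0Vmem K.
  rewrite part_sum_set0 D0 cards0; case: M => [|M]; first by rewrite subrr mul0r.
  by rewrite part_sum_set0 mulr0.
rewrite ltnS => Kn; rewrite (part_sum_rec _ xK) (big_morph D DD D0).
under eq_bigr => I /and3P[_ I0 _] do rewrite Dw //.
have D1' I : I != set0 -> I \subset K -> (#|K :\: I| < n)%N.
  move=> I0 IK; apply: leq_trans Kn; rewrite cardsD (setIidPr IK).
  by have := subset_leq_card IK; rewrite -card_gt0 in I0; lia.
(* A single block must be killed, because the right side carries [part_sum 0 K], which is 0 for
   nonempty K. *)
case: M => [|M].
  rewrite part_sum0 (_ : (K == set0) = false) ?mulr0; last by apply/negP => /eqP K0; rewrite K0 inE in xK.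
  apply: big1 => I /and3P[IK I0 xI]; rewrite part_sum0; case: (_ == set0).
    by rewrite D1; have [_ _ _ ->] := eP I I0; rewrite mulr0 addr0.
  by rewrite D0; have [_ _ -> _] := eP I I0; rewrite mulr0 addr0.
rewrite big_split /=.
have -> : \sum_(I : {set T} | [&& I \subset K, I != set0 & x0 \in I])
     e I (part_sum M.+1 (K :\: I))
  = \sum_(L : {set T} | [&& L \subset K, L != set0 & x0 \in L])
      ((#|L|%:R - 1) * w L) * part_sum M (K :\: L).
  transitivity (\sum_(I : {set T} | [&& I \subset K, I != set0 & x0 \in I])
     \sum_(J : {set T} | (J \subset K :\: I) && (J != set0))
      e I (w J) * part_sum M (K :\: I :\: J)).
    apply: eq_bigr => I /and3P[_ I0 _]; have [e1 e2 e3 e4] := eP I I0.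
    exact: part_sum_derivation.
  rewrite part_sum_regroup; apply: eq_bigr => L /and3P[_ _ xL].
  by rewrite eL.
rewrite (part_sum_rec _ xK) mulr_sumr -big_split; apply: eq_bigr => L /and3P[LK L0 xL] /=.
rewrite IH ?D1' // cardsD (setIidPr LK) natrB ?subset_leq_card //.
rewrite -[M.+1%:R]natr1; ring.
Qed.

End PartitionSums.

(** * The block coefficients and the two-block splitting identity *)

Section BlockCoefficients.
Variables (k : nat) (ns : 'I_k -> nat).
Hypothesis ns_gt1 : forall i, (1 < ns i)%N.
Implicit Types (I J L : {set 'I_k}).
Local Notation N I := (\sum_(i in I) ns i)%N.

Lemma block_sum_ge I : (2 * #|I| <= N I)%N.
Proof.
rewrite -sum1_card big_distrr /=; apply: leq_sum => i _; exact: ns_gt1.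
Qed.

(** Splitting d(I)! off the factorial of N I leaves the falling factorial that occurs in
    [ffact_split]; the remaining d(I)! is what the binomial coefficient of D cancels. *)
Lemma bcoefE I : I != set0 ->
  bcoef ns I = (N I ^_ #|I|.-1)%:R * facR (dcoef ns I) / \prod_(i in I) facR (ns i).
Proof.
rewrite -card_gt0 => I0; rewrite /bcoef; congr (_ / _).
have NI := block_sum_ge I.
rewrite /facR -natrM; congr _%:R.
have le : (#|I|.-1 <= N I)%N by lia.
rewrite -(ffact_fact le); congr (_ * _`!)%N; rewrite /dcoef.
by lia.
Qed.

(** D merges x_a and x_b into x_(a+b-1), so this says that merging the variables of two
    complementary blocks yields the variable of their union. *)
Lemma dcoefU I L : I != set0 -> I \subset L -> I != L ->
  (dcoef ns I + dcoef ns (L :\: I) = (dcoef ns L).+1)%N.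
Proof.
move=> I0 IL IL'; rewrite /dcoef cardsD (setIidPr IL).
have -> : N L = (N I + N (L :\: I))%N by rewrite (big_setID I) /= (setIidPr IL).
have := block_sum_ge I; have := block_sum_ge (L :\: I).
have := subset_leq_card IL; rewrite cardsD (setIidPr IL).
by move: #|I| #|L| (N I) (N (L :\: I)) => i l n1 n2; lia.
Qed.

(** By [bcoefE] and [dcoefU] each term is a product of two falling factorials times the constant
    (d(L) + 1)! / prod (ns i)!, the same for all I, and [ffact_split] evaluates the sum. It is the
    merging hypothesis of [part_sum_flow] at the level of coefficients. *)
Lemma bcoef_split L x0 : x0 \in L ->
  \sum_(I : {set 'I_k} | [&& I \subset L, x0 \in I & I != L])
    bcoef ns I * bcoef ns (L :\: I) * 'C(dcoef ns I + dcoef ns (L :\: I), dcoef ns I)%:R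
  = (#|L|%:R - 1) * bcoef ns L.
Proof.
move=> xL; pose c := facR (dcoef ns L).+1 / \prod_(i in L) facR (ns i).
have ns_gt0 i : (0 < ns i)%N by exact: ltnW.
transitivity (\sum_(I : {set 'I_k} | [&& I \subset L, x0 \in I & I != L])
    (N I ^_ #|I|.-1 * N (L :\: I) ^_ #|L :\: I|.-1)%:R * c).
  apply: eq_bigr => I /and3P[IL xI IL'].
  have I0 : I != set0 by apply/set0Pn; exists x0.
  have J0 : L :\: I != set0.
    by rewrite setD_eq0; apply: contra IL' => LI; rewrite eqEsubset IL.
  rewrite !bcoefE // bin_facR dcoefU // natrM /c.
  rewrite [\prod_(i in L) _](big_setID I) /= (setIidPr IL).
  have p0 (K : {set 'I_k}) : \prod_(i in K) facR (ns i) != 0.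
    by apply/prodf_neq0 => i _; exact: facR_neq0.
  move: (p0 I) (p0 (L :\: I)) (facR_neq0 (dcoef ns I)) (facR_neq0 (dcoef ns (L :\: I))).
  move: (\prod_(i in I) _) (\prod_(i in L :\: I) _) (facR (dcoef ns I)) => p q a.
  move: (facR (dcoef ns (L :\: I))) (facR _) => b f p1 q1 a1 b1.
  field; by rewrite p1 q1 a1 b1.
rewrite -mulr_suml -natr_sum (ffact_split ns_gt0 xL).
have L0 : L != set0 by apply/set0Pn; exists x0.
have L1 : (0 < #|L|)%N by rewrite card_gt0.
rewrite /c bcoefE // natrM.
rewrite -[#|L|%:R - 1](natrB _ L1) subn1.
case LE : #|L| => [|[|l]]; rewrite ?LE //= ?mul0r //.
have NL : (l.+2 <= N L)%N by apply: leq_trans (block_sum_ge L); rewrite LE leq_pmull.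
rewrite -!mulrA; congr (_ * _); rewrite !mulrA; congr (_ / _).
have dl : (dcoef ns L = N L - l.+1)%N.
  by rewrite /dcoef LE; move: (N L) NL => q NL; lia.
rewrite /facR -!natrM dl; congr _%:R.
rewrite (_ : (N L - l.+1).+1 = (N L - l)%N); last by move: (N L) NL => q NL; lia.
by rewrite !ffact_fact // ltnW // ltnW.
Qed.

End BlockCoefficients.

(* Imported only now: finmap and classical_sets shadow the finset lemmas used above. *)
From mathcomp Require Import generic_quotient ring_quotient.
From mathcomp Require Import finmap.
From mathcomp Require Import boolp classical_sets functions cardinality fsbigop.
From mathcomp Require Import monalg.

Local Open Scope classical_set_scope.
Local Open Scope quotient_scope.
Local Open Scope ring_scope.

Local Notation "1" := (@mone _) : monom_scope.
Local Notation "x * y" := (mmul x y) : monom_scope.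

(** * Polynomials in countably many variables through their monomials *)

Lemma cmonom_ind (Pr : {cmonom nat} -> Prop) :
  Pr 1%M -> (forall i m, Pr m -> Pr (ucm i * m)%M) -> forall m, Pr m.
Proof.
move=> P1 PM m; have [n] := ubnP (mdeg m); elim: n m => // n IH m lt_m.
have [/eqP|[i mi]] : mdeg m = 0%N \/ exists i, m i != 0%N.
- case: (posnP (mdeg m)); first by left.
  rewrite mdegE lt0n sum_nat_seq_neq0 => /hasP[i _ /andP[_ mi]].
  by right; exists i.
- by rewrite mdeg_eq0 => /eqP->.
have mE : m = (ucm i * divcm m (ucm i))%M.
  apply/eqP/cmP => j; rewrite cmM divcmE ucmE.
  by case: (eqVneq i j) mi => [<-|_] mi; rewrite ?subn0 // subnKC // lt0n.
rewrite mE; apply: PM; apply: IH; move: lt_m.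
by rewrite {1}mE mdegM mdegU add1n ltnS.
Qed.

Lemma linear_add (V W : lmodType rat) (T : V -> W) : linear T ->
  forall u v, T (u + v) = T u + T v.
Proof. by move=> lT u v; have := lT 1 u v; rewrite !scale1r. Qed.

Lemma linear_0 (V W : lmodType rat) (T : V -> W) : linear T -> T 0 = 0.
Proof. by move=> lT; have := lT (-1) 0 0; rewrite !scaleN1r oppr0 addr0 addNr. Qed.

Lemma linear_scale (V W : lmodType rat) (T : V -> W) : linear T ->
  forall a u, T (a *: u) = a *: T u.
Proof. by move=> lT a u; have := lT a u 0; rewrite (linear_0 lT) !addr0. Qed.

Lemma linear_opp (V W : lmodType rat) (T : V -> W) : linear T ->
  forall u, T (- u) = - T u.
Proof. by move=> lT u; rewrite -scaleN1r (linear_scale lT) scaleN1r. Qed.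

Lemma linear_sub (V W : lmodType rat) (T : V -> W) : linear T ->
  forall u v, T (u - v) = T u - T v.
Proof. by move=> lT u v; rewrite (linear_add lT) (linear_opp lT). Qed.

Lemma linear_bigsum (V W : lmodType rat) (T : V -> W) : linear T ->
  forall (I : Type) (r : seq I) (Pr : pred I) (f : I -> V),
  T (\sum_(i <- r | Pr i) f i) = \sum_(i <- r | Pr i) T (f i).
Proof.
move=> lT I r Pr f; exact: (big_morph T (linear_add lT) (linear_0 lT)).
Qed.

Lemma linear_iter (V : lmodType rat) (T : V -> V) n : linear T ->
  linear (iter n T).
Proof.
by move=> lT; elim: n => [|n IH] a u v //=; rewrite IH lT.
Qed.

Lemma comp_linear (U V W : lmodType rat) (A : V -> W) (B : U -> V) :
  linear A -> linear B -> linear (fun u => A (B u)).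
Proof. by move=> lA lB a u v; rewrite lB lA. Qed.

Lemma add_linear (U V : lmodType rat) (A B : U -> V) :
  linear A -> linear B -> linear (fun u => A u + B u).
Proof. by move=> lA lB a u v; rewrite lA lB scalerDr addrACA. Qed.

Lemma scale_linear (U V : lmodType rat) c (A : U -> V) :
  linear A -> linear (fun u => c *: A u).
Proof. by move=> lA a u v; rewrite lA scalerDr !scalerA mulrC. Qed.

Lemma sum_linear (U V : lmodType rat) (I : Type) (r : seq I) (A : I -> U -> V) :
  (forall i, linear (A i)) -> linear (fun u => \sum_(i <- r) A i u).
Proof.
move=> lA a u v; rewrite scaler_sumr -big_split; apply: eq_bigr => i _.
exact: lA.
Qed.

Lemma id_linear (U : lmodType rat) : linear (fun u : U => u).
Proof. by []. Qed.

Lemma lie_bracket_linear (V : lmodType rat) (A B : V -> V) :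
  linear A -> linear B -> linear (lie_bracket A B).
Proof.
move=> lA lB a u v; rewrite /lie_bracket lA lB lA lB scalerBr.
by rewrite opprD addrACA.
Qed.

Lemma mul_linear (A : comAlgType rat) (F : A) : linear ( *%R F).
Proof. by move=> a u v; rewrite mulrDr scalerAr. Qed.

Lemma scale_in_alg (A : comAlgType rat) a (F : A) : a *: F = in_alg A a * F.
Proof. by rewrite in_algE mulr_algl. Qed.

Lemma lie_jacobi (A : comAlgType rat) (T U W : A -> A) F :
  linear T -> linear U -> linear W ->
  lie_bracket (lie_bracket T U) W F
  = lie_bracket (lie_bracket T W) U F + lie_bracket T (lie_bracket U W) F.
Proof.
move=> lT lU lW; rewrite /lie_bracket !(linear_sub lT) !(linear_sub lU).
rewrite !(linear_sub lW); ring.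
Qed.

(* [Qx] seen through its monomial basis only: rewriting directly in [Qx] makes *)
(* conversion unfold finitely supported functions and rational arithmetic.     *)
Record polyModel := PolyModel {
  pm_alg :> comAlgType rat;
  pm_mono : {cmonom nat} -> pm_alg;
  pm_coef : {cmonom nat} -> pm_alg -> rat;
  pm_supp : pm_alg -> {fset {cmonom nat}};
  pm_mono1 : pm_mono 1%M = 1;
  pm_monoM : forall m n, pm_mono m * pm_mono n = pm_mono (m * n)%M;
  pm_coefP : forall m a F G, pm_coef m (a *: F + G) = a * pm_coef m F + pm_coef m G;
  pm_coef_mono : forall m n, pm_coef m (pm_mono n) = (n == m)%:R;
  pm_suppE : forall F m, (m \in pm_supp F) = (pm_coef m F != 0);
  pm_expand : forall F, F = \sum_(m <- pm_supp F) pm_coef m F *: pm_mono m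
}.

Section PolyModelTheory.
Variable A : polyModel.
Implicit Types (F G : A) (m : {cmonom nat}).
Local Notation mono := (@pm_mono A).

Definition pm_lift (V : lmodType rat) (phi : {cmonom nat} -> V) F : V :=
  \sum_(m <- pm_supp F) pm_coef m F *: phi m.

Lemma pm_lift_widen (V : lmodType rat) (phi : {cmonom nat} -> V) F
    (d : {fset {cmonom nat}}) :
  (pm_supp F `<=` d)%fset -> pm_lift phi F = \sum_(m <- d) pm_coef m F *: phi m.
Proof.
move=> Fd; rewrite /pm_lift (big_fset_incl _ Fd) // => m _.
by rewrite pm_suppE negbK => /eqP->; rewrite scale0r.
Qed.

Lemma pm_lift_linear (V : lmodType rat) (phi : {cmonom nat} -> V) :
  linear (pm_lift phi).
Proof.
move=> a F G; pose d := (pm_supp F `|` pm_supp G `|` pm_supp (a *: F + G))%fset.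
rewrite !(@pm_lift_widen _ _ _ d) ?fsubsetUr //; last first.
- by apply/fsubsetP => m mF; rewrite !in_fsetU mF.
- by apply/fsubsetP => m mF; rewrite !in_fsetU mF orbT.
rewrite scaler_sumr -big_split; apply: eq_bigr => m _ /=.
by rewrite pm_coefP scalerDl scalerA.
Qed.

Lemma pm_supp_mono m : pm_supp (mono m) = [fset m]%fset.
Proof.
apply/fsetP => n; rewrite pm_suppE pm_coef_mono in_fset1 (eq_sym n m).
by case: (m == n); rewrite ?oner_eq0 ?eqxx.
Qed.

Lemma pm_lift_mono (V : lmodType rat) (phi : {cmonom nat} -> V) m :
  pm_lift phi (mono m) = phi m.
Proof.
by rewrite /pm_lift pm_supp_mono big_seq_fset1 pm_coef_mono eqxx scale1r.
Qed.

Lemma pm_ind (Pr : A -> Prop) :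
  (forall a F G, Pr F -> Pr G -> Pr (a *: F + G)) ->
  Pr 0 -> (forall m, Pr (mono m)) -> forall F, Pr F.
Proof.
move=> PD P0 PM F; rewrite (pm_expand F).
by elim/big_rec: _ => // m G _ PG; exact: PD.
Qed.

Lemma linear_mono_eq (V : lmodType rat) (T U : A -> V) :
  linear T -> linear U -> (forall m, T (mono m) = U (mono m)) ->
  forall F, T F = U F.
Proof.
move=> lT lU TU; apply: pm_ind => // [a F G TF TG|].
- by rewrite lT lU TF TG.
- by rewrite (linear_0 lT) (linear_0 lU).
Qed.

Definition pm_x i : A := mono (ucm i.-1).
Definition pm_pd i : A -> A :=
  pm_lift (fun m => (m i.-1)%:R *: mono (divcm m (ucm i.-1))).

(* 0-based indices avoid the truncated predecessors of [pm_x] and [pm_pd]. *)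
Local Notation v i := (pm_x i.+1).
Local Notation pd i := (pm_pd i.+1).

Lemma pm_xM i m : v i * mono m = mono (ucm i * m)%M.
Proof. by rewrite /pm_x pm_monoM. Qed.

(** Monomials are built from 1 by multiplying with variables, past which T may be moved. Applied to
    the difference of two operators, this is the standard way below to prove that they coincide. *)
Lemma linear_comm_eq0 (T : A -> A) : linear T -> T 1 = 0 ->
  (forall i F, lie_bracket T ( *%R (v i)) F = 0) -> forall F, T F = 0.
Proof.
move=> lT T1 Tx; apply: pm_ind => [a F G TF TG||m].
- by rewrite lT TF TG scaler0 addr0.
- exact: linear_0.
elim/cmonom_ind: m => [|i m Tm]; first by rewrite pm_mono1.
rewrite -pm_xM; have := Tx i (mono m).
by rewrite /lie_bracket Tm mulr0 subr0.
Qed.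

Lemma pd_linear i : linear (pd i).
Proof. exact: pm_lift_linear. Qed.

Lemma pd_mono i m : pd i (mono m) = (m i)%:R *: mono (divcm m (ucm i)).
Proof. exact: pm_lift_mono. Qed.

Lemma pd_comm i j F : pd i (pd j F) = pd j (pd i F).
Proof.
have l k l := comp_linear (@pd_linear k) (@pd_linear l).
move: F; apply: (linear_mono_eq (l i j) (l j i)) => m.
rewrite !pd_mono !(linear_scale (@pd_linear _)) !pd_mono !scalerA.
rewrite !divcmE !ucmE eq_sym.
have -> : divcm (divcm m (ucm j)) (ucm i) = divcm (divcm m (ucm i)) (ucm j).
  by apply/eqP/cmP => k; rewrite !divcmE -!subnDA addnC.
by have [->|_] := eqVneq i j; [by [] | rewrite !subn0 mulrC].
Qed.

Lemma pd1 i : pd i 1 = 0.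
Proof. by rewrite -pm_mono1 pd_mono cm1 scale0r. Qed.

Lemma pdM i j F : pd i (v j * F) = (i == j)%:R *: F + v j * pd i F.
Proof.
move: F; apply: linear_mono_eq.
- exact: comp_linear (@pd_linear i) (@mul_linear _ _).
- apply: add_linear; first exact: (scale_linear _ (@id_linear _)).
  exact: comp_linear (@mul_linear _ _) (@pd_linear i).
move=> m.
rewrite pm_xM !pd_mono cmM cmU natrD scalerDl -scalerAr pm_xM eq_sym.
have [->|ij] := eqVneq i j.
  have -> : divcm (ucm j * m)%M (ucm j) = m.
    by apply/eqP/cmP => l; rewrite divcmE cmM addKn.
  have [->|mj] := posnP (m j); first by rewrite !scale0r.
  have -> // : (ucm j * divcm m (ucm j))%M = m.
  apply/eqP/cmP => l; rewrite cmM divcmE ucmE.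
  by have [<-|_] := eqVneq j l; rewrite ?subnKC // subn0.
rewrite !scale0r !add0r.
have -> // : divcm (ucm j * m)%M (ucm i) = (ucm j * divcm m (ucm i))%M.
apply/eqP/cmP => l; rewrite cmM !divcmE cmM !ucmE.
have [il|_] := eqVneq i l; last by rewrite !subn0.
by rewrite -il eq_sym (negPf ij) !add0n.
Qed.

Lemma pd_bound F : exists N, forall i, (N <= i)%N -> pd i F = 0.
Proof.
elim/pm_ind: F => [a F G [N HN] [M HM]||m].
- exists (maxn N M) => i; rewrite geq_max => /andP[Ni Mi].
  by rewrite (@pd_linear i a F G) (HN i Ni) (HM i Mi) scaler0 addr0.
- by exists 0%N => i _; exact: linear_0 (@pd_linear _).
exists (\max_(i <- finsupp m) i.+1)%N => i Hi; rewrite pd_mono.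
suff -> : m i = 0%N by rewrite scale0r.
apply/eqP; rewrite cmE_eq0; apply/negP => im.
by have := leq_trans (leq_bigmax_seq _ im isT) Hi; rewrite ltnn.
Qed.

End PolyModelTheory.

(** * The operator D and its commutators with the variables *)

Section Differentiation.
Variable A : polyModel.
Implicit Types (F G : A).
Local Notation v i := (pm_x A i.+1).
Local Notation pd i := (@pm_pd A i.+1).
Local Notation cc i j := ('C(i.+1 + j.+1, i.+1)%:R : rat).

Lemma fsum_pos2 (f : nat * nat -> A) N :
  (forall i j, (N <= i)%N || (N <= j)%N -> f (i.+1, j.+1) = 0) ->
  \sum_(mn \in [set mn : nat * nat | (1 <= mn.1)%N /\ (1 <= mn.2)%N]) f mn
  = \sum_(0 <= i < N) \sum_(0 <= j < N) f (i.+1, j.+1).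
Proof.
move=> f0; pose r := [seq (i.+1, j.+1) | i <- index_iota 0 N, j <- index_iota 0 N].
transitivity (\sum_(mn <- r) f mn); last exact: big_allpairs_dep.
have ur : uniq r.
  apply: allpairs_uniq; rewrite ?iota_uniq // => -[i j] [k l] _ _ /=.
  by case=> -> ->.
have rE i j : ((i, j) \in r) = [&& (0 < i)%N, (0 < j)%N, (i <= N)%N & (j <= N)%N].
  apply/allpairsP/and4P => [[[k l] /= [+ + [-> ->]]]|].
    by rewrite !mem_index_iota.
  case: i j => [|i] [|j] [] // _ _ iN jN; exists (i, j).
  by rewrite !mem_index_iota.
rewrite (fsbigE r) //; last 2 first.
- by move=> [i j] /=; rewrite rE => /and4P[].
- move=> [[|i] [|j]] /= [] //; rewrite rE /= => _ _.
  by rewrite negb_and -!leqNgt; exact: f0.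
rewrite big_seq_cond [RHS]big_seq_cond; apply: eq_bigl => -[i j].
rewrite rE; case: and4P => //= -[i0 j0 _ _].
by rewrite mem_set.
Qed.

Lemma fsum_pos (f : nat -> A) N : (forall i, (N <= i)%N -> f i.+1 = 0) ->
  \sum_(n \in [set n : nat | (1 <= n)%N]) f n = \sum_(0 <= i < N) f i.+1.
Proof.
move=> f0; rewrite -(big_map S predT f).
have ur : uniq (map S (index_iota 0 N)).
  by rewrite map_inj_uniq ?iota_uniq //; exact: succn_inj.
have rE i : (i \in map S (index_iota 0 N)) = (0 < i <= N)%N.
  by case: i => [|i]; [apply/mapP => -[] | rewrite mem_map ?mem_index_iota //; exact: succn_inj].
rewrite (fsbigE (map S (index_iota 0 N))) //; last 2 first.
- by move=> i /=; rewrite rE => /andP[].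
- by move=> [|i] //= _; rewrite rE /= -leqNgt; exact: f0.
rewrite big_seq_cond [RHS]big_seq_cond; apply: eq_bigl => i.
rewrite rE andbT; case: i => [|i]; first by rewrite ltnn.
by rewrite mem_set ?andbT.
Qed.

Definition pm_D g F : A :=
  - (g%:R *: pm_pd 1 F)
  + 2%:R^-1 *: \sum_(mn \in [set mn : nat * nat | (1 <= mn.1)%N /\ (1 <= mn.2)%N])
      'C(mn.1 + mn.2, mn.1)%:R *:
        (pm_x A (mn.1 + mn.2 - 1) * pm_pd mn.1 (pm_pd mn.2 F)).

(** The cut of [pm_D] at indices below N. It is visibly linear for fixed N, whereas the finite range
    of summation in [pm_D] depends on the argument. *)
Definition pm_DN g N F : A :=
  - (g%:R *: pd 0 F) + 2%:R^-1 *: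
    \sum_(0 <= i < N) \sum_(0 <= j < N) cc i j *: (v (i + j) * pd i (pd j F)).

Lemma pm_DNE g F N : (forall i, (N <= i)%N -> pd i F = 0) ->
  pm_D g F = pm_DN g N F.
Proof.
move=> FN; rewrite /pm_D /pm_DN (@fsum_pos2 _ N) => [|i j Nij].
  congr (_ + _ *: _); apply: eq_bigr => i _; apply: eq_bigr => j _ /=.
  by rewrite addSn addnS subn1.
have -> : pd i (pd j F) = 0; last by rewrite mulr0 scaler0.
case/orP: Nij => N_; last by rewrite FN // (linear_0 (@pd_linear _ _)).
by rewrite pd_comm FN // (linear_0 (@pd_linear _ _)).
Qed.

Lemma pm_DN_linear g N : linear (pm_DN g N).
Proof.
have L i := @pd_linear A i.
apply: add_linear.
  by move=> a F G; rewrite L !scalerDr opprD !scalerN !scalerA mulrC.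
apply: scale_linear; apply: sum_linear => i; apply: sum_linear => j.
apply: scale_linear; apply: comp_linear (@mul_linear _ _) _.
exact: comp_linear (L i) (L j).
Qed.

Lemma pd_bound2 F G : exists N, forall i, (N <= i)%N -> pd i F = 0 /\ pd i G = 0.
Proof.
have [N HN] := pd_bound F; have [M HM] := pd_bound G.
exists (maxn N M) => i; rewrite geq_max => /andP[Ni Mi].
by rewrite HN ?HM.
Qed.

Lemma pm_D_linear g : linear (pm_D g).
Proof.
move=> a F G; have [N HN] := pd_bound2 F G.
rewrite !(@pm_DNE g _ N); [exact: pm_DN_linear|by move=> i /HN[]..|].
move=> i /HN[Fi Gi].
by rewrite (@pd_linear A i a F G) Fi Gi scaler0 addr0.
Qed.

Lemma pm_D1 g : pm_D g 1 = 0.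
Proof.
rewrite (@pm_DNE g 1 0) => [|i _]; last exact: pd1.
by rewrite /pm_DN big_nil scaler0 addr0 pd1 scaler0 oppr0.
Qed.

Lemma cc_sym i j : cc i j = cc j i.
Proof. by rewrite [in RHS]addnC -[in RHS]bin_sub ?leq_addl // addnK. Qed.

Lemma sum_delta (f : nat -> A) N a : (a < N)%N ->
  \sum_(0 <= i < N) (i == a)%:R *: f i = f a.
Proof.
move=> aN; rewrite big_mkord (bigD1 (Ordinal aN)) //= eqxx scale1r big1 ?addr0 //.
by move=> i; rewrite -val_eqE /= => /negPf->; rewrite scale0r.
Qed.

(** Either of the two derivatives in the second-order part may hit [v a]; the two contributions
    agree by [cc_sym], which uses up the factor 1/2. *)
Lemma pm_DvE g a F N : (a < N)%N -> (forall i, (N <= i)%N -> pd i F = 0) ->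
  lie_bracket (pm_D g) ( *%R (v a)) F
  = - ((g * (a == 0))%:R *: F)
    + \sum_(0 <= j < N) cc a j *: (v (a + j) * pd j F).
Proof.
move=> aN FN; rewrite /lie_bracket !(@pm_DNE g _ N) //; last first.
  move=> i Ni; rewrite pdM FN // mulr0 addr0.
  by rewrite gtn_eqF ?scale0r // (leq_trans aN).
rewrite /pm_DN pdM mulrDr mulrN -[in X in _ - (- X + _)]scalerAr.
rewrite natrM eq_sym !scalerDr scalerA.
set s1 := \sum_(0 <= i < N) \sum_(0 <= j < N) _ *: (_ * pd i (pd j (_ * F))).
set s2 := \sum_(0 <= i < N) \sum_(0 <= j < N) _.
set s3 := \sum_(0 <= j < N) _.
have -> : s1 = v a * s2 + 2%:R *: s3.
  transitivity (\sum_(0 <= i < N) \sum_(0 <= j < N)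
     (v a * (cc i j *: (v (i + j) * pd i (pd j F)))
      + (j == a)%:R *: (cc i j *: (v (i + j) * pd i F))
      + (i == a)%:R *: (cc i j *: (v (i + j) * pd j F)))).
    apply: eq_bigr => i _; apply: eq_bigr => j _.
    rewrite pdM (@pd_linear A i _ F) pdM (eq_sym j a) (eq_sym i a) !scale_in_alg.
    ring.
  rewrite mulr_sumr -[2%:R *: s3]/((1 + 1) *: s3) scalerDl !scale1r addrA.
  transitivity (\sum_(0 <= i < N) v a * \sum_(0 <= j < N) cc i j *: (v (i + j) * pd i (pd j F))
    + \sum_(0 <= i < N) cc i a *: (v (i + a) * pd i F)
    + \sum_(0 <= i < N) \sum_(0 <= j < N) (i == a)%:R *: (cc i j *: (v (i + j) * pd j F))).
    rewrite -!big_split; apply: eq_bigr => i _ /=.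
    rewrite !big_split /= mulr_sumr; congr (_ + _ + _).
    by rewrite (sum_delta (fun j => cc i j *: (v (i + j) * pd i F))).
  congr (_ + _ + _).
    by apply: eq_bigr => i _; rewrite (cc_sym i a) (addnC i a).
  under eq_bigr do rewrite -scaler_sumr.
  by rewrite (sum_delta (fun i => \sum_(0 <= j < N) cc i j *: (v (i + j) * pd j F))).
rewrite !scalerDr -scalerAr scalerA mulVf // scale1r.
rewrite !scale_in_alg; ring.
Qed.

End Differentiation.

Lemma lie_scaler (V : lmodType rat) (T U W : V -> V) c :
  linear T -> (forall u, U u = c *: W u) ->
  forall u, lie_bracket T U u = c *: lie_bracket T W u.
Proof.
by move=> lT UE u; rewrite /lie_bracket !UE (linear_scale lT) scalerBr.
Qed.

Lemma lie_scalel (V : lmodType rat) (T U W : V -> V) c :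
  linear U -> (forall u, T u = c *: W u) ->
  forall u, lie_bracket T U u = c *: lie_bracket W U u.
Proof.
by move=> lU TE u; rewrite /lie_bracket !TE (linear_scale lU) scalerBr.
Qed.

Lemma lie_anti (V : lmodType rat) (T U : V -> V) u :
  lie_bracket T U u = - lie_bracket U T u.
Proof. by rewrite /lie_bracket opprB. Qed.

Lemma lie_addl (V : lmodType rat) (T U W : V -> V) c :
  linear W -> forall u,
  lie_bracket (fun u => T u + c *: U u) W u
  = lie_bracket T W u + c *: lie_bracket U W u.
Proof.
by move=> lW u; rewrite /lie_bracket (linear_add lW) (linear_scale lW) scalerBr opprD addrACA.
Qed.

Section Commutators.
Variable (A : polyModel) (g : nat).
Implicit Types (F G : A).
Local Notation v i := (pm_x A i.+1).
Local Notation mv i := ( *%R (pm_x A i.+1) : A -> A).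
Local Notation pd i := (@pm_pd A i.+1).
Local Notation cc i j := ('C(i.+1 + j.+1, i.+1)%:R : rat).
Local Notation D := (@pm_D A g).

Lemma mv_linear a : linear (mv a). Proof. exact: mul_linear. Qed.

Definition pm_E a : A -> A := lie_bracket D (mv a).

Lemma pm_E_linear a : linear (pm_E a).
Proof. exact: lie_bracket_linear (@pm_D_linear _ _) (@mv_linear _). Qed.

Lemma pm_E1 a : pm_E a 1 = - ((g * (a == 0))%:R *: 1).
Proof.
rewrite /pm_E (@pm_DvE _ g a 1 a.+1) // => [|i _]; last exact: pd1.
by rewrite big1 ?addr0 // => i _; rewrite pd1 mulr0 scaler0.
Qed.

Lemma pm_E_comm a b F : lie_bracket (pm_E a) (mv b) F = cc a b *: (v (a + b) * F).
Proof.
have [N0 HN0] := pd_bound2 F (v b * F).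
pose N := maxn N0 (maxn a.+1 b.+1).
have aN : (a < N)%N by rewrite !leq_max ltnSn !orbT.
have bN : (b < N)%N by rewrite !leq_max ltnSn !orbT.
have HN i : (N <= i)%N -> pd i F = 0 /\ pd i (v b * F) = 0.
  by move=> Ni; apply: HN0; apply: leq_trans Ni; rewrite leq_max leqnn.
rewrite /lie_bracket -/(lie_bracket _ _) /pm_E !(@pm_DvE _ g a _ N) //; try by move=> i /HN[].
rewrite mulrDr mulr_sumr mulrN -scalerAr.
have -> : \sum_(0 <= j < N) cc a j *: (v (a + j) * pd j (v b * F)) =
  \sum_(0 <= j < N) (j == b)%:R *: (cc a j *: (v (a + j) * F)) +
  \sum_(0 <= j < N) v b * (cc a j *: (v (a + j) * pd j F)).
  rewrite -big_split; apply: eq_bigr => j _; rewrite pdM !scale_in_alg /=.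
  ring.
rewrite (sum_delta (fun j => cc a j *: (v (a + j) * F))) // !scale_in_alg; ring.
Qed.

(** One family for all gradings in use: c n = n gives the degree, c n = 1 the number of variables,
    and c n = n + 1 gives h + g. *)
Definition pm_theta (c : nat -> rat) F : A :=
  \sum_(n \in [set n : nat | (1 <= n)%N]) c n *: (pm_x A n * pm_pd n F).

Lemma pm_thetaE c F N : (forall i, (N <= i)%N -> pd i F = 0) ->
  pm_theta c F = \sum_(0 <= i < N) c i.+1 *: (v i * pd i F).
Proof.
move=> FN; apply: fsum_pos => i Ni.
by rewrite FN // mulr0 scaler0.
Qed.

Lemma pm_theta_linear c : linear (pm_theta c).
Proof.
move=> a F G; have [N HN] := pd_bound2 F G.
rewrite !(@pm_thetaE _ _ N); try by move=> i /HN[].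
- apply: (@sum_linear A A nat (index_iota 0 N) (fun i F => c i.+1 *: (v i * pd i F))) => i.
  exact: scale_linear (comp_linear (@mv_linear _) (@pd_linear _ i)).
move=> i /HN[Fi Gi].
by rewrite (@pd_linear A i a F G) Fi Gi scaler0 addr0.
Qed.

Lemma pm_theta1 c : pm_theta c 1 = 0.
Proof.
by rewrite (@pm_thetaE _ _ 0) ?big_nil // => i _; exact: pd1.
Qed.

Lemma pm_theta_comm c b F : lie_bracket (pm_theta c) (mv b) F = c b.+1 *: (v b * F).
Proof.
have [N0 HN0] := pd_bound2 F (v b * F).
pose N := maxn N0 b.+1.
have bN : (b < N)%N by rewrite leq_max ltnSn orbT.
have HN i : (N <= i)%N -> pd i F = 0 /\ pd i (v b * F) = 0.
  by move=> Ni; apply: HN0; apply: leq_trans Ni; rewrite leq_max leqnn.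
rewrite /lie_bracket !(@pm_thetaE c _ N); try by move=> i /HN[].
have -> : \sum_(0 <= i < N) c i.+1 *: (v i * pd i (v b * F)) =
  \sum_(0 <= i < N) (i == b)%:R *: (c i.+1 *: (v i * F)) +
  v b * \sum_(0 <= i < N) (c i.+1 *: (v i * pd i F)).
  rewrite mulr_sumr -big_split; apply: eq_bigr => j _; rewrite pdM !scale_in_alg /=.
  ring.
by rewrite (sum_delta (fun i => c i.+1 *: (v i * F))) // addrK.
Qed.

(** The hypothesis makes c affine in the index, so that all terms of [pm_E a], each a variable of
    index a + j + 1 times the derivative of index j + 1, have the same weight c a.+1 - c 1; the
    constant term, present for a = 0 only, has weight 0 as well. *)
Lemma pm_theta_E c a F :
  (forall i j, c (i + j).+1 = c i.+1 + c j.+1 - c 1%N) ->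
  lie_bracket (pm_theta c) (pm_E a) F = (c a.+1 - c 1%N) *: pm_E a F.
Proof.
move=> cP; set k := c a.+1 - _.
have lE := @pm_E_linear a; have lT := @pm_theta_linear c.
have lTE := lie_bracket_linear lT lE.
suff : forall F, lie_bracket (pm_theta c) (pm_E a) F + (- k) *: pm_E a F = 0.
  by move=> /(_ F); rewrite scaleNr => /eqP; rewrite subr_eq0 => /eqP.
apply: linear_comm_eq0 => [||b G].
- exact: add_linear lTE (scale_linear _ lE).
- rewrite /lie_bracket pm_theta1 !pm_E1 (linear_0 lE) (linear_opp lT).
  rewrite (linear_scale lT) pm_theta1 scaler0 subr0 oppr0 add0r /k.
  by case: a {lE lTE k} => [|a]; rewrite ?subrr ?oppr0 ?scale0r // muln0 scale0r oppr0 scaler0.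
rewrite lie_addl; last exact: mv_linear.
rewrite lie_jacobi //; last exact: mv_linear.
rewrite (lie_scalel lE (@pm_theta_comm c b)) (lie_scaler lT (@pm_E_comm a b)).
rewrite pm_E_comm pm_theta_comm.
rewrite (lie_anti (mv b)) pm_E_comm.
rewrite !scale_in_alg cP /k; ring.
Qed.

Lemma pm_theta_D c F :
  (forall i j, c (i + j).+1 = c i.+1 + c j.+1 - c 1%N) ->
  lie_bracket (pm_theta c) D F = - (c 1%N *: D F).
Proof.
move=> cP; have lT := @pm_theta_linear c.
have lD := @pm_D_linear A g.
suff : forall F, lie_bracket (pm_theta c) D F + c 1%N *: D F = 0.
  by move=> /(_ F)/eqP; rewrite addr_eq0 => /eqP.
apply: linear_comm_eq0 => [||b G].
- by apply: add_linear; [exact: lie_bracket_linear|exact: scale_linear].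
- by rewrite /lie_bracket pm_theta1 pm_D1 (linear_0 lD) (linear_0 lT) subr0 scaler0 addr0.
rewrite lie_addl; last exact: mv_linear.
rewrite lie_jacobi //; last exact: mv_linear.
rewrite (lie_scalel lD (@pm_theta_comm c b)) -/(pm_E b) pm_theta_E //.
rewrite (lie_anti (mv b)) -/(pm_E b G).
rewrite !scale_in_alg; ring.
Qed.

Lemma pd0_E a F : lie_bracket (pd 0) (pm_E a) F = (2 * (a == 0))%:R *: pd 0 F.
Proof.
have lE := @pm_E_linear a; have lp := @pd_linear A 0.
set k := _%:R.
suff : forall F, lie_bracket (pd 0) (pm_E a) F + (- k) *: pd 0 F = 0.
  by move=> /(_ F); rewrite scaleNr => /eqP; rewrite subr_eq0 => /eqP.
apply: linear_comm_eq0 => [||b G].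
- by apply: add_linear; [exact: lie_bracket_linear|exact: scale_linear].
- rewrite /lie_bracket pd1 pm_E1 (linear_0 lE) (linear_opp lp).
  by rewrite (linear_scale lp) pd1 !scaler0 subr0 oppr0 add0r.
rewrite lie_addl; last exact: mv_linear.
rewrite lie_jacobi //; last exact: mv_linear.
have pdv i H : lie_bracket (pd 0) (mv i) H = (0 == i)%:R *: H.
  by rewrite /lie_bracket pdM addrK.
rewrite (lie_scalel lE (pdv b)) (lie_scaler lp (@pm_E_comm a b)).
rewrite !pdv /lie_bracket subrr scaler0 add0r !scalerA -scalerDl.
case: a b @k {lE} => [|a] [|b] k /=; rewrite /k ?mulr0 ?muln0 ?oppr0 ?addr0 ?scale0r //.
Qed.

(** Among the coefficients of D only that of m = n = 1 contains x_1, with factor 'C(2, 1) / 2 = 1.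
    Consequently D maps polynomials free of x_1 to polynomials free of x_1. *)
Lemma pd0_D F : pd 0 (D F) = D (pd 0 F) + pd 0 (pd 0 F).
Proof.
have lD := @pm_D_linear A g; have lp := @pd_linear A 0.
suff : forall F, lie_bracket (pd 0) D F + (- 1%R) *: pd 0 (pd 0 F) = 0.
  move=> /(_ F)/eqP; rewrite /lie_bracket scaleN1r subr_eq0 => /eqP H.
  by rewrite -H addrC subrK.
have lpp := comp_linear lp lp.
apply: linear_comm_eq0 => [||b G].
- by apply: add_linear; [exact: lie_bracket_linear|exact: scale_linear].
- by rewrite /lie_bracket pm_D1 pd1 !(linear_0 lp) (linear_0 lD) subr0 scaler0 addr0.
rewrite lie_addl; last exact: mv_linear.
rewrite lie_jacobi //; last exact: mv_linear.
have pdv i H : lie_bracket (pd 0) (mv i) H = (0 == i)%:R *: H.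
  by rewrite /lie_bracket pdM addrK.
rewrite (lie_scalel lD (pdv b)) -/(pm_E b) pd0_E.
rewrite /lie_bracket subrr scaler0 add0r !pdM lp !pdM.
case: b => [|b] /=; first by rewrite !scale_in_alg; ring.
by rewrite muln0 !scale0r !add0r subrr scaler0.
Qed.

End Commutators.

(* p^i q^k / k! and p q^(b+1) / (b+1)! bracket to a multiple of this number. *)
Definition pq_coef k b : rat := facR (k + b) / (facR k * facR b.+1).

Lemma bin_pq_coef k b : 'C(k + b, b.+1)%:R = k%:R * pq_coef k b.
Proof.
case: k => [|k]; first by rewrite bin_small // mul0r.
rewrite /pq_coef addSnnS addnC bin_facR (facRS k) -natr1.
by field; rewrite !facR_neq0 natr1_neq0.
Qed.

Lemma binS_pq_coef k b : 'C(k.+1 + b, b.+1)%:R = (k + b).+1%:R * pq_coef k b.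
Proof.
rewrite /pq_coef (_ : (k.+1 + b)%N = (b.+1 + k)%N); last by lia.
rewrite bin_facR (_ : (b.+1 + k)%N = (k + b).+1); last by lia.
by rewrite (facRS (k + b)) -natr1 mulrA (mulrC (facR b.+1)).
Qed.

(** The scalar form of the Jacobi identity for an iterated commutator, [pm_E b] and the variable
    [v a]; once everything is written with factorials, a polynomial identity remains. *)
Lemma pq_coef_jacobi i k a b :
  (i.+1%:R * 'C(k.+1 + a, a.+1)%:R) *
    (((i * b.+1)%:R - (k.+1 + a)%:R) * pq_coef (k.+1 + a) b)
  + 'C(b.+1 + a.+1, b.+1)%:R * (i.+1%:R * 'C(k.+1 + (b + a), (b + a).+1)%:R)
  - (((i.+1 * b.+1)%:R - k%:R) * pq_coef k b) *
    (i.+1%:R * 'C((k + b).+1 + a, a.+1)%:R) = 0.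
Proof.
rewrite (_ : (k.+1 + a)%N = (a.+1 + k)%N); last by lia.
rewrite (_ : (k.+1 + (b + a))%N = ((b + a).+1 + k)%N); last by lia.
rewrite (_ : ((k + b).+1 + a)%N = (a.+1 + (k + b))%N); last by lia.
rewrite !bin_facR /pq_coef.
rewrite (_ : (a.+1 + k + b)%N = (a.+1 + (k + b))%N); last by lia.
rewrite (_ : ((b + a).+1 + k)%N = (a.+1 + (k + b))%N); last by lia.
rewrite (_ : (b.+1 + a.+1)%N = (b + a).+2); last by lia.
rewrite (facRS (b + a).+1) !(natrM, natrD) -!natr1 !natrD.
field.
by rewrite !facR_neq0.
Qed.

(** * The sl2 relations, iterated commutators with D, and the ideal property *)

Section AdjointPowers.
Variable (A : polyModel) (g : nat).
Implicit Types (F G : A).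
Local Notation v i := (pm_x A i.+1).
Local Notation mv i := ( *%R (pm_x A i.+1) : A -> A).
Local Notation D := (@pm_D A g).
Local Notation E := (@pm_E A g).

Definition pm_h F : A :=
  - (g%:R *: F)
  + \sum_(n \in [set n : nat | (1 <= n)%N]) n.+1%:R *: (pm_x A n * pm_pd n F).

Lemma pm_h_theta F : pm_h F = - (g%:R *: F) + pm_theta (fun n => n.+1%:R) F.
Proof. by []. Qed.

Lemma pm_h_linear : linear pm_h.
Proof.
apply: add_linear; last exact: pm_theta_linear.
by move=> a F G; rewrite scalerDr opprD scalerN !scalerA mulrC.
Qed.

Lemma pm_D_x1 F : D (v 0 * F) = v 0 * D F + pm_h F.
Proof.
apply/eqP; rewrite addrC -subr_eq -/(lie_bracket D (mv 0) F); apply/eqP.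
have [N0 HN0] := pd_bound F; pose N := N0.+1.
have HN i : (N <= i)%N -> pm_pd i.+1 F = 0 by move/ltnW/HN0.
rewrite (@pm_DvE _ g 0 F N) // pm_h_theta (@pm_thetaE _ _ F N) // muln1.
by congr (_ + _); apply: eq_bigr => i _; rewrite bin1 add1n.
Qed.

Lemma pm_h_x1 F : pm_h (v 0 * F) = v 0 * pm_h F + 2%:R *: (v 0 * F).
Proof.
rewrite !pm_h_theta -(pm_theta_comm (fun n => n.+1%:R) 0 F) /lie_bracket.
by rewrite !scale_in_alg; ring.
Qed.

Lemma pm_h_D F : pm_h (D F) = D (pm_h F) - 2%:R *: D F.
Proof.
have lD := @pm_D_linear A g.
rewrite !pm_h_theta (linear_add lD) (linear_opp lD) (linear_scale lD) -addrA.
congr (_ + _); apply/eqP; rewrite addrC -subr_eq; apply/eqP.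
by apply: (@pm_theta_D _ g (fun n => n.+1%:R)) => i j; rewrite -!natr1 natrD; ring.
Qed.

Definition pm_X i n : A -> A := iter i (lie_bracket D) (mv n).

Lemma pm_X_linear i n : linear (pm_X i n).
Proof.
elim: i => [|i IH]; first exact: mv_linear.
exact: lie_bracket_linear (@pm_D_linear _ _) IH.
Qed.

Lemma pm_X_one i n : pm_X i n 1 = iter i D (v n).
Proof.
elim: i => [|i IH]; first exact: mulr1.
by rewrite iterS -IH -[LHS]/(D (pm_X i n 1) - pm_X i n (D 1)) pm_D1 (linear_0 (@pm_X_linear _ _)) subr0.
Qed.

Lemma pm_XS_one i n :
  pm_X i.+1 n 1 = (if i is 0 then - (g * (n == 0))%:R else 0 : rat) *: 1.
Proof.
have E1 : D (v n) = - (g * (n == 0))%:R *: 1.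
  by rewrite -[LHS](pm_X_one 1) [LHS](@pm_E1 A g n) scaleNr.
rewrite pm_X_one iterSr E1; case: i => //= i.
have lD := linear_iter i (@pm_D_linear A g).
rewrite -iterS iterSr (linear_scale (@pm_D_linear A g)) pm_D1 scaler0.
by rewrite (linear_0 lD) scale0r.
Qed.

(* [pm_X i n] behaves like p^i q^(n+2-i) / (n+2-i)! under the Poisson bracket, *)
(* with D = p^2 / 2 and x_(n+1) = q^(n+2) / (n+2)!; this gives the constants. *)
Lemma pm_X_lie i :
  (forall n k b F, n.+2 = (i + k)%N ->
     lie_bracket (pm_X i.+1 n) (mv b) F
     = (i.+1%:R * 'C(k + b, b.+1)%:R) *: pm_X i (n + b) F) /\
  (forall n k b F, n.+2 = (i + k)%N ->
     lie_bracket (pm_X i n) (E b) F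
     = (((i * b.+1)%:R - k%:R) * pq_coef k b) *: pm_X i (n + b) F).
Proof.
have lX := pm_X_linear; have lv := @mv_linear A; have lE := @pm_E_linear A g.
have lD := @pm_D_linear A g.
(* Both families advance together. The bracket with [E b] at level i.+1 is tested against a variable
   by the Jacobi identity, which needs both hypotheses; the bracket of [pm_X i.+2 n] with a variable
   is then D bracketed with a known operator, minus the bracket of [pm_X i.+1 n] with [E b]. *)
elim: i => [|i [IA IB]].
  split=> n k b F; rewrite add0n => <-.
    rewrite mul1r; have -> : 'C(n.+2 + b, b.+1) = 'C(n.+1 + b.+1, n.+1).
      by rewrite addSnnS -bin_sub ?leq_addl // addnK.
    exact: pm_E_comm.
  rewrite lie_anti pm_E_comm (addnC b n) -scaleNr; congr (_ *: _).
  rewrite bin_facR /pq_coef mul0n (_ : (b.+1 + n.+1)%N = (n.+2 + b)%N); last by lia.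
  rewrite (facRS n.+1) -!natr1.
  by field; rewrite !facR_neq0 !natr1 Num.Theory.pnatr_eq0.
have IA' : forall n k b F, n.+2 = (i.+1 + k)%N ->
    lie_bracket (pm_X i.+1 n) (mv b) F
    = (i.+1%:R * 'C(k.+1 + b, b.+1)%:R) *: pm_X i (n + b) F.
  by move=> n k b F nk; rewrite (@IA _ k.+1) // nk addSnnS.
have IB' : forall n k b F, n.+2 = (i.+1 + k)%N ->
     lie_bracket (pm_X i.+1 n) (E b) F
     = (((i.+1 * b.+1)%:R - k%:R) * pq_coef k b) *: pm_X i.+1 (n + b) F.
  move=> n k b F nk; set be := _ * pq_coef k b.
  have lXE := lie_bracket_linear (lX i.+1 n) (lE b).
  suff : forall F, lie_bracket (pm_X i.+1 n) (E b) F + (- be) *: pm_X i.+1 (n + b) F = 0.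
    by move=> /(_ F); rewrite scaleNr => /eqP; rewrite subr_eq0 => /eqP.
  apply: linear_comm_eq0 => [||a G].
  - exact: add_linear lXE (scale_linear _ (lX _ _)).
  - rewrite /lie_bracket pm_E1 -scaleNr (linear_scale (lX _ _)) !pm_XS_one.
    rewrite (linear_scale (lE b)) pm_E1 -!scaleNr !scalerA -!scalerDl.
    set t := (if i is 0 then - (g * (n + b == 0))%:R else 0).
    (* The constant t can be nonzero only if i = n = b = 0; then k = 1, and the factor i.+1 * b.+1 -
       k of [be] vanishes. *)
    suff Ht : be * t = 0.
      by set c := (X in X *: _); suff -> : c = 0; [rewrite scale0r | rewrite -oppr0 -Ht /c; ring].
    rewrite /t {t}.
    case: i nk @be {IA IB IA' lXE} => [|i] nk be; last by rewrite mulr0.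
    case: n nk => [|n] nk; last by rewrite /= muln0 oppr0 mulr0.
    case: b @be => [|b] be; last by rewrite /= muln0 oppr0 mulr0.
    have k1 : k = 1%N by lia.
    by rewrite /be k1 muln1 subrr !mul0r.
  rewrite lie_addl // lie_jacobi //.
  rewrite (lie_scalel (lE b) (fun u => IA' n k a u nk)).
  rewrite (lie_scaler (lX i.+1 n) (@pm_E_comm A g b a)).
  have nk2 : (n + a).+2 = (i + (k.+1 + a))%N by rewrite -addSn -addSn nk; lia.
  have nk3 : (n + b).+2 = (i.+1 + (k + b))%N by rewrite -addSn -addSn nk; lia.
  rewrite (@IB _ (k.+1 + a)%N) // (@IA' _ k) // (@IA' _ (k + b)%N) //.
  rewrite addnAC [(n + (b + a))%N]addnA.
  rewrite !scalerA -!scalerDl.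
  set c := (X in X *: _); suff -> : c = 0 by rewrite scale0r.
  by rewrite /c /be mulNr; exact: pq_coef_jacobi.
split; last exact: IB'.
move=> n k b F nk.
rewrite -/(lie_bracket D (pm_X i.+1 n)) (lie_jacobi _ lD (lX i.+1 n) (lv b)).
rewrite (lie_scaler lD (fun u => IA' n k b u nk)).
have -> : lie_bracket (lie_bracket D (mv b)) (pm_X i.+1 n) F
  = - lie_bracket (pm_X i.+1 n) (E b) F by exact: lie_anti.
rewrite (IB' _ _ _ _ nk) -[lie_bracket D _ F]/(pm_X i.+1 (n + b) F).
rewrite -scaleNr -scalerDl; congr (_ *: _).
rewrite binS_pq_coef bin_pq_coef natrM -!natr1 natrD; ring.
Qed.

(** After n.+2 commutators the exponent k of q is 0, so the brackets of the next one with the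
    variables carry the coefficient 'C(b, b.+1) = 0. *)
Lemma pm_X_eq0 n F : pm_X n.+3 n F = 0.
Proof.
move: F; apply: linear_comm_eq0 => [||b F]; first exact: pm_X_linear.
  by rewrite pm_XS_one scale0r.
have [XA _] := pm_X_lie n.+2.
by rewrite (XA n 0%N) ?addn0 // bin_small // mulr0 scale0r.
Qed.

Definition pm_J F : Prop := forall n, exists G, F = iter n D G.

Lemma pm_J_linear a F G : pm_J F -> pm_J G -> pm_J (a *: F + G).
Proof.
move=> JF JG n; have [F' ->] := JF n; have [G' ->] := JG n.
by exists (a *: F' + G'); rewrite (linear_iter n (@pm_D_linear A g)).
Qed.

Lemma pm_J0 : pm_J 0.
Proof. by move=> n; exists 0; rewrite (linear_0 (linear_iter n (@pm_D_linear A g))). Qed.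

Lemma pm_JD F G : pm_J F -> pm_J G -> pm_J (F + G).
Proof. by move=> JF JG; rewrite -[F]scale1r; exact: pm_J_linear. Qed.

Lemma pm_JZ a F : pm_J F -> pm_J (a *: F).
Proof. by move=> JF; rewrite -[_ *: _]addr0; apply: pm_J_linear JF pm_J0. Qed.

Lemma pm_J_sum (I : Type) (r : seq I) (P : pred I) (f : I -> A) :
  (forall i, P i -> pm_J (f i)) -> pm_J (\sum_(i <- r | P i) f i).
Proof. by move=> Jf; elim/big_rec: _ => [|i F Pi]; [exact: pm_J0|apply: pm_JD; exact: Jf]. Qed.

Lemma pm_J_D F : pm_J F -> pm_J (D F).
Proof. by move=> JF n; have [G ->] := JF n; exists (D G); rewrite -iterS iterSr. Qed.

(* Each commutator with [D] costs one power of [D]. *)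
Lemma pm_X_image n i : exists k, forall p F, exists G,
  pm_X (n.+3 - i) n (iter (p + k) D F) = iter p D G.
Proof.
elim: i => [|i [k IH]].
  by exists 0%N => p F; exists 0; rewrite subn0 pm_X_eq0 (linear_0 (linear_iter p (@pm_D_linear A g))).
have [ni|ni] := leqP n.+3 i.
  by exists k => p F; rewrite (_ : (n.+3 - i.+1)%N = (n.+3 - i)%N) //; lia.
set j := (n.+3 - i.+1)%N; have jE : (n.+3 - i)%N = j.+1 by rewrite /j; lia.
exists k.+1; elim=> [|p IHp] F; first by exists (pm_X j n (iter (0 + k.+1) D F)).
have [G1 E1] := IHp F; have [G2 E2] := IH p.+1 F.
(* Moving one D to the left costs a term with one more commutator. That term is covered by the outer
   hypothesis, the main term by induction on p. *)
have XE H : pm_X j n (D H) = D (pm_X j n H) - pm_X j.+1 n H.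
  by rewrite -[pm_X j.+1 n H]/(D (pm_X j n H) - pm_X j n (D H)) subKr.
exists (G1 - G2); rewrite addSn [iter _.+1 D F]iterS XE E1 -jE.
rewrite -addSnnS E2.
by rewrite (linear_sub (linear_iter p.+1 (@pm_D_linear A g))).
Qed.

Lemma pm_J_x i F : pm_J F -> pm_J (v i * F).
Proof.
move=> JF p; have [k Hk] := pm_X_image i i.+3.
have [G ->] := JF (p + k)%N; have [G' E'] := Hk p G.
by exists G'; rewrite -E' subnn.
Qed.

Lemma pm_J_mul F G : pm_J G -> pm_J (F * G).
Proof.
move=> JG; elim/pm_ind: F => [a F F' JF JF'||m].
- by rewrite mulrDl -scalerAl; exact: pm_J_linear.
- by rewrite mul0r; exact: pm_J0.
elim/cmonom_ind: m => [|i m Jm]; first by rewrite pm_mono1 mul1r.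
by rewrite -pm_xM -mulrA; exact: pm_J_x.
Qed.

End AdjointPowers.

(** * Truncated exponentials of D *)

Lemma alternating_bin_sum (R : comPzRingType) t :
  \sum_(i < t.+1) (-1) ^+ i * 'C(t, i)%:R = (t == 0)%:R :> R.
Proof.
have := exprDn (1 : R) (-1) t; rewrite subrr expr0n => ->.
by apply: eq_bigr => i _; rewrite expr1n mul1r mulr_natr.
Qed.

(** The identity exp(-X) exp(X) = 1 with X^t replaced by u t. As u vanishes from N on, both
    exponentials may be cut at N. *)
Lemma double_exp_sum (V : lmodType rat) (u : nat -> V) N :
  (forall t, (N <= t)%N -> u t = 0) ->
  \sum_(0 <= r < N) \sum_(0 <= s < N)
    ((-1) ^+ r / (r`!%:R * s`!%:R)) *: u (r + s)%N = u 0%N.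
Proof.
move=> uN; pose c r s : rat := (-1) ^+ r / (r`!%:R * s`!%:R).
transitivity (\sum_(0 <= r < N) \sum_(0 <= t < N | (r <= t)%N) c r (t - r)%N *: u t).
  apply: eq_big_nat => r /andP[_ rN].
  rewrite (big_cat_nat (n := (N - r)%N)) ?leq_subr //= [X in _ + X]big_nat_cond.
  rewrite [X in _ + X]big1 ?addr0 => [|s /andP[/andP[Ns _] _]]; last first.
    by rewrite uN ?scaler0 //; lia.
  rewrite [RHS](big_cat_nat (n := r)) //=; last exact: ltnW.
  rewrite [X in _ = X + _]big_nat_cond [X in _ = X + _]big1 ?add0r; last first.
    by move=> t /andP[/andP[_ tr]]; rewrite leqNgt tr.
  transitivity (\sum_(0 + r <= t < N | (r <= t)%N) c r (t - r)%N *: u t); last by rewrite add0n.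
  rewrite big_addn; apply: congr_big_nat => // [t _|t _]; first by rewrite leq_addl.
  by rewrite addnK addnC.
rewrite (exchange_big_dep_nat predT) //=.
transitivity (\sum_(0 <= t < N) (t == 0)%:R *: u t).
  apply: eq_big_nat => t /andP[_ tN].
  rewrite -scaler_suml; congr (_ *: _).
  transitivity (\sum_(0 <= i < t.+1) c i (t - i)%N).
    by rewrite (big_nat_widen 0 t.+1 N) //; apply: eq_bigl => i; rewrite ltnS.
  transitivity ((\sum_(i < t.+1) (-1) ^+ i * 'C(t, i)%:R) / t`!%:R : rat).
    rewrite mulr_suml big_mkord; apply: eq_bigr => i _; rewrite /c -mulrA.
    have it : (i <= t)%N by rewrite -ltnS.
    congr (_ * _); rewrite -(bin_fact it) natrM [RHS]mulrC [in RHS]invfM mulrAC mulVf ?mul1r ?natrM //.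
    by rewrite Num.Theory.pnatr_eq0 -lt0n bin_gt0.
  by rewrite alternating_bin_sum; case: t tN => [|t] _; rewrite ?mul0r ?divr1.
case: N uN => [|N] uN; first by rewrite big_nil uN.
by rewrite big_ltn // scale1r big_nat_cond big1 ?addr0 // => -[|t] //= _; rewrite scale0r.
Qed.

Section Exponential.
Variable (A : polyModel) (g : nat).
Implicit Types (y F G : A).
Local Notation x1 := (pm_x A 1).
Local Notation D := (@pm_D A g).
Local Notation h := (@pm_h A g).

Let lD : linear D := @pm_D_linear A g.
Let lh : linear h := @pm_h_linear A g.

Definition pm_dp (a : int) : A :=
  if a is Posz n then n`!%:R^-1 *: x1 ^+ n else 0.

Lemma pm_dp0 : pm_dp 0 = 1.
Proof. by rewrite -[LHS]/(0`!%:R^-1 *: x1 ^+ 0) fact0 invr1 scale1r. Qed.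

(** The rule holds for every integer: at a = -1, where the divided power jumps from 0 to 1, the
    factor a + 1 is 0. *)
Lemma pm_dp_x1 a : x1 * pm_dp a = (a + 1)%:~R *: pm_dp (a + 1).
Proof.
case: a => [n|[|n]].
- rewrite -PoszD addn1 /= -scalerAr -exprS factS natrM invfM scalerA.
  by rewrite -pmulrn mulrA mulfV ?mul1r // Num.Theory.pnatr_eq0.
- by rewrite /= mulr0 scale0r.
- by rewrite /= mulr0 (_ : Negz n.+1 + 1 = Negz n) ?scaler0 //; lia.
Qed.

Lemma pm_dpS n : pm_dp n.+1 = n.+1%:R^-1 *: (x1 * pm_dp n).
Proof.
rewrite pm_dp_x1 -PoszD addn1 -pmulrn scalerA mulVf ?scale1r //.
by rewrite Num.Theory.pnatr_eq0.
Qed.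

Lemma h_dp l y a : h y = l *: y -> h (pm_dp a * y) = (l + 2%:R * a%:~R) *: (pm_dp a * y).
Proof.
move=> hy; case: a => [n|n]; last by rewrite mul0r (linear_0 lh) scaler0.
elim: n => [|n IH]; first by rewrite pm_dp0 mul1r mulr0 addr0.
rewrite pm_dpS -scalerAl -mulrA (linear_scale lh) pm_h_x1 IH.
rewrite -scalerAr -scalerDl scalerA mulrC -scalerA; congr (_ *: _).
by rewrite -!pmulrn -natr1; ring.
Qed.

Lemma D_dp l y a : h y = l *: y ->
  D (pm_dp a * y) = pm_dp a * D y + (a%:~R - 1 + l) *: (pm_dp (a - 1) * y).
Proof.
move=> hy; case: a => [n|n]; last by rewrite !mul0r (linear_0 lD) scaler0 addr0.
elim: n => [|n IH]; first by rewrite pm_dp0 !mul1r mul0r scaler0 addr0.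
have n0 : n.+1%:R != 0 :> rat by rewrite Num.Theory.pnatr_eq0.
apply: (scalerI n0).
rewrite {1}pm_dpS -scalerAl (linear_scale lD) scalerA mulfV // scale1r -mulrA.
rewrite pm_D_x1 IH (h_dp _ hy) mulrDr -scalerAr [x1 * (pm_dp (_ - 1) * _)]mulrA pm_dp_x1 subrK.
rewrite [x1 * (_ * _)]mulrA pm_dp_x1 (_ : (n : int) + 1 = n.+1); last by lia.
rewrite (_ : (n.+1 : int) - 1 = n); last by lia.
rewrite -!pmulrn -natr1 !scale_in_alg; ring.
Qed.

Lemma h_iter_D l y r : h y = l *: y -> h (iter r D y) = (l - 2%:R * r%:R) *: iter r D y.
Proof.
move=> hy; elim: r => [|r IH]; first by rewrite mulr0 subr0.
rewrite iterS pm_h_D IH (linear_scale lD) -scalerBl -natr1; congr (_ *: _); ring.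
Qed.

(* The coefficient of t^a in exp(x1 t) exp(D / t) y, cut at D^N. *)
Definition pm_P N (a : int) y : A :=
  \sum_(0 <= r < N) r`!%:R^-1 *: (pm_dp (a + r%:Z) * iter r D y).

Lemma pm_P_S N a y :
  pm_P N.+1 a y = pm_P N a y + N`!%:R^-1 *: (pm_dp (a + N%:Z) * iter N D y).
Proof. by rewrite /pm_P big_nat_recr. Qed.

Lemma pm_P_linear N a : linear (pm_P N a).
Proof.
apply: (@sum_linear A A nat (index_iota 0 N)
  (fun r y => r`!%:R^-1 *: (pm_dp (a + r%:Z) * iter r D y))) => r.
exact: scale_linear (comp_linear (@mul_linear _ _) (linear_iter _ lD)).
Qed.

Lemma iter_D_eq0 N M y : (N <= M)%N -> iter N D y = 0 -> iter M D y = 0.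
Proof. by move=> NM y0; rewrite -(subnK NM) iterD y0 (linear_0 (linear_iter _ lD)). Qed.

Lemma pm_P_widen N M a y : (N <= M)%N -> iter N D y = 0 -> pm_P M a y = pm_P N a y.
Proof.
move=> NM y0; rewrite /pm_P (big_cat_nat (n := N)) //= [X in _ + X]big_nat_cond.
rewrite [X in _ + X]big1 ?addr0 // => r /andP[/andP[Nr _] _].
by rewrite (iter_D_eq0 Nr) // mulr0 scaler0.
Qed.

Lemma h_P N l a y : h y = l *: y -> h (pm_P N a y) = (2%:R * a%:~R + l) *: pm_P N a y.
Proof.
move=> hy; rewrite (linear_bigsum lh) scaler_sumr; apply: eq_bigr => r _.
rewrite (linear_scale lh) (h_dp _ (h_iter_D r hy)) !scalerA mulrC.
by congr (_ *: _); rewrite rmorphD /=; ring.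
Qed.

(** As D^r y has weight l - 2r, the r-th term yields the coefficient a - 1 + l - r; the preceding
    term, in which D acts on D^(r-1) y, contributes the missing r. *)
Lemma D_P N l a y : h y = l *: y -> iter N D y = 0 ->
  D (pm_P N a y) = (a%:~R - 1 + l) *: pm_P N (a - 1) y.
Proof.
move=> hy yN.
(* Cutting the sum at N leaves one boundary term proportional to D^N y. With it the formula needs no
   vanishing and goes through by induction on N. *)
suff {yN} : D (pm_P N a y) = (a%:~R - 1 + l) *: pm_P N (a - 1) y
     + (N%:R / N`!%:R) *: (pm_dp (a - 1 + N%:Z) * iter N D y).
  by rewrite yN mulr0 scaler0 addr0.
elim: N => [|N IH].
  by rewrite /pm_P !big_nil (linear_0 lD) mul0r scale0r scaler0 addr0.
rewrite !pm_P_S (linear_add lD) IH (linear_scale lD) (D_dp _ (h_iter_D N hy)).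
have -> : N.+1%:R / N.+1`!%:R = N`!%:R^-1 :> rat.
  by rewrite factS natrM invfM mulrA mulfV ?mul1r // Num.Theory.pnatr_eq0.
rewrite (_ : a - 1 + N.+1%:Z = a + N%:Z); last by lia.
rewrite (_ : a + N%:Z - 1 = a - 1 + N%:Z); last by lia.
rewrite iterS rmorphD /= !scale_in_alg -pmulrn; ring.
Qed.

Lemma x1_P N a y : iter N D y = 0 ->
  x1 * pm_P N a y = (a + 1)%:~R *: pm_P N (a + 1) y + pm_P N (a + 2) (D y).
Proof.
move=> yN.
(* As in [D_P], the boundary term of the cut is kept for the induction on N. *)
suff {yN} : x1 * pm_P N a y + (N%:R / N`!%:R) *: (pm_dp (a + 1 + N%:Z) * iter N D y)
   = (a + 1)%:~R *: pm_P N (a + 1) y + pm_P N (a + 2) (D y).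
  by rewrite yN mulr0 scaler0 addr0.
elim: N => [|N IH].
  by rewrite /pm_P !big_nil mulr0 mul0r scale0r scaler0 addr0.
rewrite !pm_P_S -iterSr scalerDr addrACA -IH mulrDr.
have -> : N.+1%:R / N.+1`!%:R = N`!%:R^-1 :> rat.
  by rewrite factS natrM invfM mulrA mulfV ?mul1r // Num.Theory.pnatr_eq0.
rewrite -[x1 * (_ *: _)]scalerAr mulrA pm_dp_x1.
rewrite (_ : a + 1 + N.+1%:Z = a + 2 + N%:Z); last by lia.
rewrite (_ : a + N%:Z + 1 = a + 1 + N%:Z); last by lia.
rewrite !rmorphD /= !scale_in_alg -pmulrn; ring.
Qed.

Lemma dp_P N n y : iter N D y = 0 ->
  pm_dp n * y = \sum_(0 <= r < N) ((-1) ^+ r / r`!%:R) *: pm_P N (n + r%:Z) (iter r D y).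
Proof.
move=> yN.
pose u t := pm_dp (n + t%:Z) * iter t D y.
have uN t : (N <= t)%N -> u t = 0 by move=> Nt; rewrite /u (iter_D_eq0 Nt) ?mulr0.
have -> : pm_dp n * y = u 0%N by rewrite /u addr0.
rewrite -(double_exp_sum uN); apply: eq_bigr => r _; rewrite scaler_sumr.
apply: eq_bigr => s _; rewrite scalerA /u -iterD (addnC s r) PoszD addrA.
by rewrite invfM mulrA.
Qed.

Lemma pm_J_P N (l : int) a y : h y = l%:~R *: y -> iter N D y = 0 ->
  1 <= a + l -> pm_J g (pm_P N a y).
Proof.
move=> hy yN al n; elim: n a al => [|n IH] a al; first by exists (pm_P N a y).
have [|G EG] := IH (a + 1); first by lia.
have := D_P (a + 1) hy yN; rewrite addrK EG => E.
have al0 : (a + 1)%:~R - 1 + l%:~R != 0 :> rat.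
  rewrite -[1]/(1%:~R) -rmorphB -rmorphD /= intr_eq0.
  by apply/eqP; lia.
exists (((a + 1)%:~R - 1 + l%:~R)^-1 *: G).
by rewrite iterS (linear_scale (linear_iter _ lD)) (linear_scale lD) E scalerA mulVf ?scale1r.
Qed.

(** In [dp_P] the r-th term has index n + r and weight l - 2r, so [pm_J_P] asks for n + l - r >= 1,
    while r is at most N - 1. *)
Lemma pm_J_dp N (n : int) (l : int) y : h y = l%:~R *: y -> iter N D y = 0 ->
  N%:Z <= n + l -> pm_J g (pm_dp n * y).
Proof.
move=> hy yN Nnl; rewrite (dp_P n yN) big_nat; apply: pm_J_sum => r rN.
apply: pm_JZ; apply: (@pm_J_P N (l - 2 * r%:Z)).
- by rewrite (h_iter_D r hy) rmorphB rmorphM /= -pmulrn.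
- by rewrite -iterD (iter_D_eq0 _ yN) ?leq_addr.
- by lia.
Qed.

End Exponential.

(** * Bihomogeneous elements and the ideal *)

Implicit Types (m : {cmonom nat}).

Definition nwt (w : nat -> nat) m := (\sum_(i <- finsupp m) m i * w i)%N.

Lemma nwtEw w m (d : {fset nat}) : (finsupp m `<=` d)%fset ->
  nwt w m = (\sum_(i <- d) m i * w i)%N.
Proof.
move=> le; rewrite /nwt (big_fset_incl _ le) // => i _.
by rewrite -cmE_neq0 negbK => /eqP->.
Qed.

Lemma nwtM w m n : nwt w (m * n)%M = (nwt w m + nwt w n)%N.
Proof.
rewrite {1}/nwt mdomD (nwtEw w (fsubsetUl _ (finsupp n))).
rewrite (nwtEw w (fsubsetUr (finsupp m) _)) -big_split /=.
by apply: eq_bigr => i _; rewrite cmM mulnDl.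
Qed.

Lemma nwtU w i : nwt w (ucm i) = w i.
Proof. by rewrite /nwt mdomU big_seq_fset1 cmUU mul1n. Qed.

Lemma nwt1 w : nwt w 1%M = 0%N.
Proof. by rewrite /nwt mdom1 big_seq_fset0. Qed.

Lemma mdeg_nwt m : mdeg m = nwt (fun=> 1%N) m.
Proof. by apply: eq_bigr => i _; rewrite muln1. Qed.

Lemma wdegM m n : wdeg (m * n)%M = (wdeg m + wdeg n)%N.
Proof. exact: nwtM. Qed.

Lemma wdegU i : wdeg (ucm i) = i.+1.
Proof. exact: nwtU. Qed.

Lemma mdeg_le_wdeg m : (mdeg m <= wdeg m)%N.
Proof. by apply: leq_sum => i _; rewrite leq_pmulr. Qed.

Lemma mdeg2_le_wdeg m : m 0%N = 0%N -> (2 * mdeg m <= wdeg m)%N.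
Proof.
move=> m0; rewrite /mdeg /wdeg big_distrr /=; apply: leq_sum => -[|i] _.
  by rewrite m0.
by rewrite mulnC leq_mul.
Qed.

Lemma cm0_le_mdeg m : (m 0%N <= mdeg m)%N.
Proof.
case: (mdomP m 0%N) => // im.
by rewrite /mdeg (big_fsetD1 0%N) //= leq_addr.
Qed.

Lemma mdeg0_wdeg m : mdeg m = 0%N -> wdeg m = 0%N.
Proof. by move/mdeg_eq0I->; exact: nwt1. Qed.

Definition ucm_iter i n m := iter n (fun k => ucm i * k)%M m.

Lemma ucm_iterE i n m j : ucm_iter i n m j = (n * (i == j) + m j)%N.
Proof.
elim: n => [|n IH]; first by rewrite mul0n.
by rewrite /ucm_iter iterS -/(ucm_iter _ _ _) cmM ucmE IH mulSn addnA.
Qed.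

Lemma wdeg_ucm_iter i n m : wdeg (ucm_iter i n m) = (n * i.+1 + wdeg m)%N.
Proof.
elim: n => [|n IH]; first by rewrite mul0n.
by rewrite /ucm_iter iterS -/(ucm_iter _ _ _) wdegM wdegU IH mulSn addnA.
Qed.

Lemma mdeg_ucm_iter i n m : mdeg (ucm_iter i n m) = (n + mdeg m)%N.
Proof.
elim: n => [|n IH]; first by rewrite add0n.
by rewrite /ucm_iter iterS -/(ucm_iter _ _ _) mdegM mdegU IH addnA.
Qed.

(** The factor of m free of x_1, the variable with index 0 in the monomial type. *)
Definition cm_rest m := iter (m 0%N) (fun k => divcm k (ucm 0%N)) m.

Lemma cm_restE m j : cm_rest m j = if j is 0 then 0%N else m j.
Proof.
have E n k : iter n (fun k => divcm k (ucm 0%N)) k j = (k j - n * (j == 0%N))%N.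
  elim: n => [|n IH]; first by rewrite subn0.
  by rewrite iterS divcmE ucmE IH -subnDA mulSn addnC eq_sym.
by rewrite /cm_rest E; case: j {E} => [|j]; rewrite ?muln1 ?subnn ?muln0 ?subn0.
Qed.

Lemma cm_rest_ucm_iter m n : m 0%N = 0%N -> cm_rest (ucm_iter 0 n m) = m.
Proof.
move=> m0; apply/eqP/cmP => -[|j]; rewrite cm_restE // ucm_iterE.
by rewrite muln0.
Qed.

Lemma cm_rest_split m : m = ucm_iter 0 (m 0%N) (cm_rest m).
Proof.
apply/eqP/cmP => j; rewrite ucm_iterE cm_restE.
by case: j => [|j]; rewrite ?muln1 ?addn0 ?muln0.
Qed.

Section Homogeneous.
Variable (A : polyModel) (g : nat).
Implicit Types (y F G : A).
Local Notation mono := (@pm_mono A).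
Local Notation v i := (pm_x A i.+1).
Local Notation pd i := (@pm_pd A i.+1).
Local Notation D := (@pm_D A g).
Local Notation h := (@pm_h A g).
Local Notation thD := (@pm_theta A (fun n => n%:R)).
Local Notation thN := (@pm_theta A (fun=> 1)).

Lemma x_exp_mono i n m : v i ^+ n * mono m = mono (ucm_iter i n m).
Proof.
elim: n => [|n IH]; first by rewrite mul1r.
by rewrite exprS -mulrA IH pm_xM.
Qed.

Lemma pm_dp_mono (n : nat) m : pm_dp A n * mono m = n`!%:R^-1 *: mono (ucm_iter 0 n m).
Proof. by rewrite -scalerAl x_exp_mono. Qed.

Lemma mono_dp m : mono m = (m 0%N)`!%:R *: (pm_dp A (m 0%N) * mono (cm_rest m)).
Proof.
rewrite pm_dp_mono scalerA mulfV ?scale1r -?cm_rest_split //.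
exact: facR_neq0.
Qed.

Lemma theta_mono c w m : (forall i, c i.+1 = (w i)%:R) ->
  pm_theta c (mono m) = (nwt w m)%:R *: mono m.
Proof.
move=> cw; elim/cmonom_ind: m => [|i m IH].
  by rewrite pm_mono1 pm_theta1 nwt1 scale0r.
rewrite -pm_xM; have /eqP := @pm_theta_comm A c i (mono m).
rewrite /lie_bracket IH subr_eq => /eqP->.
by rewrite nwtM nwtU natrD scalerDl cw -scalerAr.
Qed.

Lemma supp_eq0 F : (forall m, m \notin pm_supp F) -> F = 0.
Proof.
move=> NF; rewrite (pm_expand F) big_seq big1 // => m mF.
by have := NF m; rewrite mF.
Qed.

Lemma pm_coef_linear m : linear (pm_coef m : A -> rat^o).
Proof. by move=> a F G; rewrite pm_coefP. Qed.

Lemma pm_coefZ m a F : pm_coef m (a *: F) = a * pm_coef m F.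
Proof. exact: (linear_scale (@pm_coef_linear m)). Qed.

Lemma coef_diag (T : A -> A) (tau : {cmonom nat} -> rat) : linear T ->
  (forall m, T (mono m) = tau m *: mono m) ->
  forall m F, pm_coef m (T F) = tau m * pm_coef m F.
Proof.
move=> lT Tm m; apply: (@linear_mono_eq A rat^o (fun F => pm_coef m (T F))
   (fun F => tau m * pm_coef m F)).
- by move=> a F G; rewrite lT pm_coefP.
- by move=> a F G; rewrite pm_coefP mulrDr mulrCA.
move=> n; rewrite Tm pm_coefZ pm_coef_mono.
by case: (eqVneq n m) => [->|_]; rewrite ?mulr0.
Qed.

Lemma coef_pd0 m F : pm_coef m (pd 0 F) = (m 0%N).+1%:R * pm_coef (ucm 0%N * m)%M F.
Proof.
move: F; apply: (@linear_mono_eq A rat^o (fun F => pm_coef m (pd 0 F))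
   (fun F => (m 0%N).+1%:R * pm_coef (ucm 0%N * m)%M F)).
- by move=> a F G; rewrite (@pd_linear A 0) pm_coefP.
- by move=> a F G; rewrite pm_coefP mulrDr mulrCA.
move=> n; rewrite pd_mono pm_coefZ !pm_coef_mono.
have [->|nm] := eqVneq n (ucm 0%N * m)%M.
  rewrite cmM cmUU add1n mulr1.
  have -> : divcm (ucm 0%N * m)%M (ucm 0%N) = m.
    by apply/eqP/cmP => j; rewrite divcmE cmM addKn.
  by rewrite eqxx mulr1.
have [n0|n0] := posnP (n 0%N); first by rewrite n0 mul0r mulr0.
have [dm|_] := eqVneq (divcm n (ucm 0%N)) m; last by rewrite !mulr0.
case/negP: nm; rewrite -dm; apply/cmP => j; rewrite cmM divcmE ucmE.
by case: j => [|j] /=; rewrite ?subnKC // subn0.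
Qed.

Lemma pd0_supp F m : pd 0 F = 0 -> m \in pm_supp F -> m 0%N = 0%N.
Proof.
move=> F0; rewrite pm_suppE; case: (posnP (m 0%N)) => // m0.
have mE : m = (ucm 0%N * divcm m (ucm 0%N))%M.
  apply/eqP/cmP => j; rewrite cmM divcmE ucmE.
  by case: j => [|j] /=; rewrite ?subnKC // subn0.
have := coef_pd0 (divcm m (ucm 0%N)) F.
rewrite F0 -mE (linear_0 (@pm_coef_linear _)) => /esym/eqP.
by rewrite mulf_eq0 Num.Theory.pnatr_eq0 => /= ->.
Qed.

(* Bihomogeneous of degree [d] for deg x_i = i, and [k] for deg x_i = 1. *)
Definition bihom (d k : int) F := thD F = d%:~R *: F /\ thN F = k%:~R *: F.

Lemma hom_mono m : bihom (wdeg m) (mdeg m) (mono m).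
Proof.
split; first exact: (@theta_mono _ S).
by rewrite mdeg_nwt; exact: (@theta_mono _ (fun=> 1%N)).
Qed.

Lemma hom_supp d k F m : bihom d k F -> m \in pm_supp F ->
  d = wdeg m /\ k = mdeg m.
Proof.
move=> [Fd Fk]; rewrite pm_suppE => m0.
have Dd := coef_diag (@pm_theta_linear A _) (fun n => (hom_mono n).1) m F.
have Dk := coef_diag (@pm_theta_linear A _) (fun n => (hom_mono n).2) m F.
rewrite Fd pm_coefZ in Dd; rewrite Fk pm_coefZ in Dk.
have /(@intr_inj rat) <- := mulIf m0 Dd.
by have /(@intr_inj rat) <- := mulIf m0 Dk.
Qed.

Lemma hom_h d k F : bihom d k F -> h F = (d + k - g%:Z)%:~R *: F.
Proof.
move=> [Fd Fk]; rewrite pm_h_theta.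
have -> : pm_theta (fun n => n.+1%:R) F = thD F + thN F.
  have [N FN] := pd_bound F.
  rewrite !(pm_thetaE _ FN) -big_split; apply: eq_bigr => i _ /=.
  by rewrite -scalerDl natr1.
rewrite Fd Fk -scaleNr -!scalerDl; congr (_ *: _).
by rewrite rmorphB rmorphD /= -pmulrn; ring.
Qed.

Lemma hom_D d k F : bihom d k F -> bihom (d - 1) (k - 1) (D F).
Proof.
have lD := @pm_D_linear A g.
move=> [Fd Fk]; split.
  have cP i j : (i + j).+1%:R = i.+1%:R + j.+1%:R - 1%N%:R :> rat.
    by rewrite -[in LHS]natr1 -[i.+1%:R]natr1 -[j.+1%:R]natr1 natrD; ring.
  have /eqP := @pm_theta_D A g (fun n => n%:R) F cP.
  rewrite /lie_bracket Fd (linear_scale lD) subr_eq => /eqP->.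
  by rewrite addrC -scalerBl rmorphB.
have cP (i j : nat) : 1 = 1 + 1 - 1 :> rat by rewrite addrK.
have /eqP := @pm_theta_D A g (fun=> 1) F cP.
rewrite /lie_bracket Fk (linear_scale lD) subr_eq => /eqP->.
by rewrite addrC -scalerBl rmorphB.
Qed.

Lemma hom_iter_D d k r F : bihom d k F -> bihom (d - r%:Z) (k - r%:Z) (iter r D F).
Proof.
move=> hF; elim: r => [|r IH]; first by rewrite !subr0.
have := hom_D IH; rewrite iterS.
by rewrite (_ : d - r%:Z - 1 = d - r.+1%:Z) 1?(_ : k - r%:Z - 1 = k - r.+1%:Z) //; lia.
Qed.

Lemma hom_neg d k F : bihom d k F -> (d < 0)%R -> F = 0.
Proof.
by move=> hF d0; apply: supp_eq0 => m; apply/negP => /(hom_supp hF)[]; lia.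
Qed.

Lemma pd0_iter_D r y : pd 0 y = 0 -> pd 0 (iter r D y) = 0.
Proof.
move=> y0; elim: r => [|r IH] //.
by rewrite iterS pd0_D IH (linear_0 (@pd_linear A 0)) addr0 (linear_0 (@pm_D_linear A g)).
Qed.

(* Without x_1 every variable has degree at least 2, and each application of D *)
(* lowers both the degree and the number of variables by one.                  *)
Lemma iter_D_nil (d k : nat) r y : bihom d k y -> pd 0 y = 0 ->
  (k < r)%N || (k == r) && (k < d)%N -> iter r D y = 0.
Proof.
move=> hy y0 kr; apply: supp_eq0 => m; apply/negP => my.
have [md mk] := hom_supp (hom_iter_D r hy) my.
have m0 := pd0_supp (pd0_iter_D r y0) my.
have := @mdeg0_wdeg m; lia.
Qed.

Lemma pd0_mono m : m 0%N = 0%N -> pd 0 (mono m) = 0.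
Proof. by move=> m0; rewrite pd_mono m0 scale0r. Qed.

Lemma wdeg_rest m : wdeg m = (m 0%N + wdeg (cm_rest m))%N.
Proof. by rewrite {1}(cm_rest_split m) wdeg_ucm_iter muln1. Qed.

Lemma mdeg_rest m : mdeg m = (m 0%N + mdeg (cm_rest m))%N.
Proof. by rewrite {1}(cm_rest_split m) mdeg_ucm_iter. Qed.

(** Write m as a power of x_1 times y, with y free of x_1 and in k variables. The quantity to be
    compared with N in [pm_J_dp] is wdeg m + k - g. In degree above g the cut N = k + 1 always
    works; in degree g one needs N = k, that is D^k y = 0, which holds because y is not constant. *)
Lemma pm_J_mono m : (g < wdeg m)%N || (wdeg m == g) && (m 0%N < g)%N ->
  pm_J g (mono m).
Proof.
move=> mg; rewrite mono_dp; apply: pm_JZ.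
have r0 : cm_rest m 0%N = 0%N by rewrite cm_restE.
have hr := hom_mono (cm_rest m); have p0 := pd0_mono r0.
have := wdeg_rest m; have := mdeg2_le_wdeg r0; have := @mdeg0_wdeg (cm_rest m).
move=> w0 w2 wm.
have [gw|] := boolP (g < wdeg m)%N.
  apply: (@pm_J_dp _ _ (mdeg (cm_rest m)).+1 _ _ _ (hom_h hr)); last first.
    by move: w0 w2 wm gw mg; move: (mdeg _) (wdeg _) (m 0%N) (wdeg m) => a b c e; lia.
  by apply: (iter_D_nil hr p0); rewrite leqnn.
move=> gw; apply: (@pm_J_dp _ _ (mdeg (cm_rest m)) _ _ _ (hom_h hr)); last first.
    by move: w0 w2 wm gw mg; move: (mdeg _) (wdeg _) (m 0%N) (wdeg m) => a b c e; lia.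
by apply: (iter_D_nil hr p0); rewrite eqxx ltnn /=; lia.
Qed.

End Homogeneous.

Lemma lspan_sum (V : lmodType rat) (B : set V) (I : eqType) (r : seq I) (f : I -> V) :
  (forall i, i \in r -> lspan B (f i)) -> lspan B (\sum_(i <- r) f i).
Proof.
move=> Bf; rewrite big_seq; elim/big_rec: _ => [|i v ir Bv]; first exact: lspan0.
by apply: lspanD => //; exact: Bf.
Qed.

Lemma lspan_gen (V : lmodType rat) (B : set V) v : B v -> lspan B v.
Proof.
move=> Bv; exists [:: (1, v)]; split=> [c|]; last by rewrite big_seq1 scale1r.
by rewrite inE => /eqP->.
Qed.

(** * The span of the generators equals the intersection of the images *)

Section Ideal.
Variable (A : polyModel) (g : nat).
Implicit Types (F G : A).
Local Notation mono := (@pm_mono A).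
Local Notation D := (@pm_D A g).

Let lD : linear D := @pm_D_linear A g.

Definition pm_gens : set A :=
  [set F : A | exists2 d, (g < d)%N & forall m, m \in pm_supp F -> wdeg m = d]
  `|` [set F : A | exists (d k : nat) (e : nat -> nat),
        [/\ (\sum_(1 <= i < k.+1) i * e i)%N = g, (e 1 < g)%N &
            F = iter d D (\prod_(1 <= i < k.+1) pm_x A i ^+ e i)]].

Lemma prod_mono k (e : nat -> nat) : exists m,
  [/\ \prod_(1 <= i < k.+1) pm_x A i ^+ e i = mono m,
      forall j, m j = (if (j < k)%N then e j.+1 else 0%N)
    & wdeg m = (\sum_(1 <= i < k.+1) i * e i)%N].
Proof.
elim: k => [|k [m [mE m_ wm]]].
  exists 1%M; split=> [|j|]; first by rewrite big_nil pm_mono1.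
    by rewrite cm1.
  by rewrite big_nil; exact: nwt1.
exists (ucm_iter k (e k.+1) m); split=> [|j|].
- by rewrite big_nat_recr //= mE mulrC x_exp_mono.
- rewrite ucm_iterE m_ ltnS; case: (ltngtP k j) => [kj|kj|<-] /=.
  + by rewrite muln0.
  + by rewrite muln0.
  + by rewrite muln1 addn0.
by rewrite big_nat_recr //= -wm wdeg_ucm_iter addnC mulnC.
Qed.

Lemma mono_prod m : exists k, mono m = \prod_(1 <= i < k.+1) pm_x A i ^+ m i.-1
  /\ (\sum_(1 <= i < k.+1) i * m i.-1)%N = wdeg m.
Proof.
pose k := (\max_(i <- finsupp m) i.+1)%N; exists k.
have [n [nE n_ wn]] := prod_mono k (fun i => m i.-1).
suff mn : m = n by split; [rewrite nE mn | rewrite -wn mn].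
apply/eqP/cmP => j; rewrite n_; case: ltnP => // kj.
apply/eqP; rewrite cmE_eq0; apply/negP => jm.
by have := leq_trans (leq_bigmax_seq _ jm isT) kj; rewrite ltnn.
Qed.

(** Equality of degree and number of variables forces m = x_1^(g+1), and the scalar a - 1 + l of
    [D_dp] vanishes at a = g + 1, l = -g. This is why x_1^g is excluded from the generators. *)
Lemma D_pure m : wdeg m = g.+1 -> mdeg m = g.+1 -> D (mono m) = 0.
Proof.
move=> wm dm; rewrite mono_dp (linear_scale lD).
have r0 : cm_rest m 0%N = 0%N by rewrite cm_restE.
have := wdeg_rest m; have := mdeg_rest m; have := mdeg2_le_wdeg r0.
rewrite wm dm => w2 dr wr.
have /mdeg_eq0I r1 : mdeg (cm_rest m) = 0%N.
  by move: w2 dr wr; move: (mdeg _) (wdeg _) (m 0%N) => a b c; lia.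
move: dr; rewrite r1 mdeg1 addn0 => <-; rewrite pm_mono1.
have h1 : @pm_h A g 1 = (- g%:R) *: 1.
  by rewrite pm_h_theta pm_theta1 addr0 scaleNr.
rewrite (D_dp _ h1) pm_D1 mulr0 add0r -pmulrn -natr1 addrK subrr scale0r.
exact: scaler0.
Qed.

Lemma gens_sub_J F : lspan pm_gens F -> pm_J g F.
Proof.
move=> [s [sB ->]]; rewrite big_seq; apply: pm_J_sum => c /sB Bc; apply: pm_JZ.
case: Bc => [[d gd Fd]|[d [k [e [eg e1 ->]]]]].
  rewrite (pm_expand c.2) big_seq; apply: pm_J_sum => m mc; apply: pm_JZ.
  by apply: pm_J_mono; rewrite (Fd _ mc) gd.
have [m [-> m_ wm]] := prod_mono k e.
elim: d => [|d IH]; last by rewrite iterS; exact: pm_J_D.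
apply: pm_J_mono; rewrite wm eg eqxx m_ ltnn /=.
by case: ifP => // _; apply: leq_ltn_trans e1.
Qed.

Lemma lspan_top m i : (g < wdeg m - i)%N -> lspan pm_gens (iter i D (mono m)).
Proof.
move=> gm; apply: lspan_gen; left; exists (wdeg m - i)%N => // n nm.
have [wE _] := hom_supp (hom_iter_D g i (hom_mono A m)) nm.
by move: wE gm; move: (wdeg m) (wdeg n) => a b; lia.
Qed.

(** Only the image of D^(g+1) is needed. On a monomial of degree at most g this power vanishes, and
    from degree 2g + 2 on the result has degree above g. In between, D is first applied until degree
    g is reached; the monomials found there other than x_1^g, with the remaining powers of D, are
    generators. *)
Lemma J_sub_gens F : pm_J g F -> lspan pm_gens F.
Proof.
move=> /(_ g.+1)[G ->]; rewrite (pm_expand G).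
rewrite (linear_bigsum (linear_iter _ lD)); apply: lspan_sum => m _.
rewrite (linear_scale (linear_iter _ lD)); apply: lspanZ.
have hm := hom_mono A m; have hD r := hom_iter_D g r hm.
have [wg|gw] := leqP (wdeg m) g.
  rewrite (hom_neg (hD g.+1)); first exact: lspan0.
  by move: wg; move: (wdeg m) => a; lia.
have [w2|w2] := leqP (2 * g).+2 (wdeg m).
  by apply: lspan_top; lia.
pose q := (wdeg m - g.+1)%N.
have -> : iter g.+1 D (mono m) = iter (g - q)%N D (D (iter q D (mono m))).
  rewrite -iterS -iterD (_ : (g - q + q.+1)%N = g.+1) // /q.
  by move: gw w2; move: (wdeg m) => a; lia.
set H := iter q D (mono m); have hH : bihom g.+1%:Z ((mdeg m)%:Z - q%:Z) H.
  have := hD q; rewrite (_ : (wdeg m)%:Z - q%:Z = g.+1) //.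
  by rewrite /q; move: gw; move: (wdeg m) => a; lia.
(* If x_1^g occurred in D H, then by bihomogeneity H would have degree g + 1 in g + 1 variables, so
   it would be a multiple of x_1^(g+1), which D kills. *)
have Dm n : n \in pm_supp (D H) -> wdeg n = g /\ (n 0%N < g)%N.
  move=> nH; have [wn dn] := hom_supp (hom_D g hH) nH.
  have {}wn : wdeg n = g by move: wn; move: (wdeg n) => a; lia.
  split=> //; rewrite ltnNge; apply/negP => gn.
  have dn0 := mdeg_le_wdeg n; have n0 := cm0_le_mdeg n.
  have dng : mdeg n = g by move: dn0 n0 gn; rewrite wn; move: (mdeg n) (n 0%N) => a b; lia.
  suff H0 : D H = 0.
    by move: nH; rewrite H0 pm_suppE (linear_0 (@pm_coef_linear _ _)) eqxx.
  rewrite (pm_expand H) (linear_bigsum lD) big_seq big1 // => p pH.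
  have [wp dp] := hom_supp hH pH.
  rewrite (linear_scale lD) D_pure ?scaler0 //.
    by move: wp; move: (wdeg p) => a; lia.
  by move: dn dp; rewrite dng; move: (mdeg p) (mdeg m) => a b; lia.
rewrite (pm_expand (D H)) (linear_bigsum (linear_iter _ lD)); apply: lspan_sum => n nH.
rewrite (linear_scale (linear_iter _ lD)); apply: lspanZ; apply: lspan_gen; right.
have [wn ng] := Dm n nH; have [k [kE kw]] := mono_prod n.
exists (g - q)%N, k, (fun i => n i.-1); split=> //; first by rewrite kw.
by rewrite -kE.
Qed.

Lemma lspan_gensE F : lspan pm_gens F <-> pm_J g F.
Proof. by split; [exact: gens_sub_J | exact: J_sub_gens]. Qed.

End Ideal.

(** * The operator S *)

Section Fourier.
Variable (A : polyModel) (g : nat).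
Implicit Types (y F G : A) (d k a : int).
Local Notation mono := (@pm_mono A).
Local Notation x1 := (pm_x A 1).
Local Notation pd i := (@pm_pd A i.+1).
Local Notation D := (@pm_D A g).
Local Notation h := (@pm_h A g).
Local Notation J := (@pm_J A g).
Local Notation dp := (pm_dp A).
Local Notation P := (@pm_P A g).

Let lD : linear D := @pm_D_linear A g.
Let lh : linear h := @pm_h_linear A g.

(** S is defined through P, from which the sl2 relations can be read off; the partition formula is
    recovered later. With n the exponent of x_1, the remaining factor has degree wdeg m - n in mdeg
    m - n variables, so -l - n is the index written here, and n! converts x_1^n into a divided
    power. The cut exceeds the number of remaining variables. *)
Definition pm_S_mono m : A := ((m 0%N)`!%:R * (-1) ^+ (m 0%N)) *:
  P (mdeg m).+1 (g%:Z - (wdeg m)%:Z - (mdeg m)%:Z + (m 0%N)%:Z) (mono (cm_rest m)).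

Definition pm_S : A -> A := pm_lift pm_S_mono.

Lemma pm_S_linear : linear pm_S.
Proof. exact: pm_lift_linear. Qed.

Let lS := pm_S_linear.

Definition x1_free d k N y := [/\ bihom d k y, pd 0 y = 0 & iter N D y = 0].

Lemma x1_free_h d k N y : x1_free d k N y -> h y = (d + k - g%:Z)%:~R *: y.
Proof. by case=> /hom_h->. Qed.

Lemma x1_free_iter d k N r y : x1_free d k N y ->
  x1_free (d - r%:Z) (k - r%:Z) N (iter r D y).
Proof.
case=> hy y0 yN; split; [exact: hom_iter_D|exact: pd0_iter_D|].
by rewrite -iterD (iter_D_eq0 _ yN) // leq_addr.
Qed.

Lemma x1_free_mono m : m 0%N = 0%N ->
  x1_free (wdeg m) (mdeg m) (mdeg m).+1 (mono m).
Proof.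
move=> m0; split; [exact: hom_mono|exact: pd0_mono|].
by apply: (iter_D_nil g (hom_mono A m) (pd0_mono A m0)); rewrite leqnn.
Qed.

(** The index of P depends on y only through d and k, so the formula passes from monomials to
    bihomogeneous y. This is needed because D^r y is not a monomial. *)
Lemma pm_S_dp d k N y (n : nat) : x1_free d k N y ->
  pm_S (dp n * y) = (-1) ^+ n *: P N (g%:Z - d - k - n%:Z) y.
Proof.
(* A cut that is large enough for y and for all its monomials at once. *)
move=> [hy y0 yN]; pose M := (maxn N (`|k|%N).+1).
rewrite -(pm_P_widen _ (leq_maxl N (`|k|%N).+1) yN) -/M.
rewrite [in LHS](pm_expand y) [in RHS](pm_expand y) mulr_sumr.
rewrite (linear_bigsum lS) (linear_bigsum (@pm_P_linear _ _ _ _)) scaler_sumr.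
rewrite big_seq [RHS]big_seq; apply: eq_bigr => m my.
have [-> kE] := hom_supp hy my; have m0 := pd0_supp y0 my.
rewrite -scalerAr (linear_scale lS) (linear_scale (@pm_P_linear _ _ _ _)).
rewrite [RHS]scalerA (mulrC ((-1) ^+ n)) -scalerA; congr (_ *: _).
rewrite pm_dp_mono (linear_scale lS) /pm_S pm_lift_mono /pm_S_mono.
rewrite cm_rest_ucm_iter // ucm_iterE m0 eqxx muln1 addn0.
rewrite scalerA mulrA mulVf ?mul1r; last exact: facR_neq0.
congr (_ *: _); rewrite wdeg_ucm_iter mdeg_ucm_iter muln1.
have [_ _ mN] := x1_free_mono m0.
rewrite (@pm_P_widen _ _ (mdeg m).+1) ?ltnS ?leq_addl //.
rewrite (@pm_P_widen _ _ (mdeg m).+1 M) //; last by rewrite leq_max kE absz_nat leqnn orbT.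
by congr (P _ _ _); rewrite kE; move: (mdeg m) (wdeg m) => a b; lia.
Qed.

Lemma dp_ind (Pr : A -> Prop) :
  (forall c F G, Pr F -> Pr G -> Pr (c *: F + G)) -> Pr 0 ->
  (forall (n : nat) (d k N : nat) y, x1_free d k N y -> Pr (dp n * y)) -> forall F, Pr F.
Proof.
move=> PD P0 PM; apply: pm_ind => // m; rewrite mono_dp -[_ *: _]addr0.
by apply: PD => //; apply: PM; apply: x1_free_mono; rewrite cm_restE.
Qed.

Lemma pm_S_x1 F : pm_S (x1 * F) = D (pm_S F).
Proof.
move: F; apply: dp_ind => [c F G SF SG||n d k N y yf].
- by rewrite mulrDr -scalerAr !lS SF SG lD.
- by rewrite mulr0 !(linear_0 lS) (linear_0 lD).
have [_ _ yN] := yf.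
rewrite mulrA pm_dp_x1 -scalerAl (linear_scale lS) -PoszD addn1 !(pm_S_dp _ yf).
rewrite (linear_scale lD) (D_P _ (x1_free_h yf) yN) !scalerA.
rewrite (_ : g%:Z - d%:Z - k%:Z - n%:Z - 1 = g%:Z - d%:Z - k%:Z - n.+1%:Z); last by lia.
congr (_ *: _); rewrite exprS !(rmorphB, rmorphD) /= -!pmulrn -natr1; ring.
Qed.

Lemma pm_S_h F : pm_S (h F) = - h (pm_S F).
Proof.
move: F; apply: dp_ind => [c F G SF SG||n d k N y yf].
- by rewrite lh !lS SF SG lh scalerN -opprD.
- by rewrite !(linear_0 lh, linear_0 lS) oppr0.
have hy := x1_free_h yf.
rewrite (h_dp _ hy) (linear_scale lS) !(pm_S_dp _ yf) (linear_scale lh) (h_P _ _ hy).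
rewrite !scalerA -scaleNr; congr (_ *: _); rewrite !(rmorphB, rmorphD) /=; ring.
Qed.

(** By [x1_P] the two sides agree exactly when x_1 occurs. For n = 0 the left side has an extra
    multiple of P_(1-l)(y), and it lies in J since its index plus l is 1. *)
Lemma pm_S_D F : J (x1 * pm_S F - pm_S (D F)).
Proof.
move: F; apply: dp_ind => [c F G SF SG||n d k N y yf].
- have -> : x1 * pm_S (c *: F + G) - pm_S (D (c *: F + G)) =
     c *: (x1 * pm_S F - pm_S (D F)) + (x1 * pm_S G - pm_S (D G)).
    by rewrite lD !lS mulrDr -scalerAr scalerBr opprD addrACA.
  exact: pm_J_linear.
- by rewrite (linear_0 lD) (linear_0 lS) mulr0 subr0; exact: pm_J0.
have hy := x1_free_h yf; have [_ _ yN] := yf.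
have yf1 := x1_free_iter 1 yf.
rewrite (D_dp _ hy) (linear_add lS) (linear_scale lS) (pm_S_dp _ yf) (pm_S_dp _ yf1).
rewrite -scalerAr (x1_P _ yN).
case: n => [|n].
  rewrite mul0r (linear_0 lS) scaler0 !expr0 !scale1r !subr0.
  rewrite (_ : g%:Z - (d%:Z - 1%:Z) - (k%:Z - 1%:Z) = g%:Z - d%:Z - k%:Z + 2); last by lia.
  rewrite -[iter 1 D y]/(D y) addr0 addrK; apply: pm_JZ; apply: (pm_J_P hy yN); lia.
rewrite (_ : n.+1%:Z - 1 = n); last by lia.
rewrite (pm_S_dp _ yf) -[iter 1 D y]/(D y).
rewrite (_ : g%:Z - (d%:Z - 1%:Z) - (k%:Z - 1%:Z) - n.+1%:Z = g%:Z - d%:Z - k%:Z - n.+1%:Z + 2); last by lia.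
rewrite (_ : g%:Z - d%:Z - k%:Z - n.+1%:Z + 1 = g%:Z - d%:Z - k%:Z - n%:Z); last by lia.
set u := P _ _ y; set w := P _ _ _.
suff -> : (-1) ^+ n.+1 *: ((g%:Z - d%:Z - k%:Z - n%:Z)%:~R *: u + w) -
  ((-1) ^+ n.+1 *: w + (n.+1%:~R - 1 + (d%:Z + k%:Z - g%:Z)%:~R) *: ((-1) ^+ n *: u)) = 0.
  exact: pm_J0.
rewrite exprS !(rmorphB, rmorphD) /= -!pmulrn -natr1 !scale_in_alg; ring.
Qed.

Lemma pm_J_sub F G : J F -> J G -> J (F - G).
Proof. by move=> JF JG; rewrite -scaleN1r addrC; exact: pm_J_linear. Qed.

Lemma pm_S_iter_D n F : J (x1 ^+ n * pm_S F - pm_S (iter n D F)).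
Proof.
elim: n => [|n IH]; first by rewrite mul1r subrr; exact: pm_J0.
have -> : x1 ^+ n.+1 * pm_S F - pm_S (iter n.+1 D F) =
   x1 * (x1 ^+ n * pm_S F - pm_S (iter n D F))
   + (x1 * pm_S (iter n D F) - pm_S (D (iter n D F))).
  by rewrite exprS -iterS; ring.
by apply: pm_JD (pm_S_D _); exact: pm_J_mul.
Qed.

Lemma pm_J_x1_exp F : J (x1 ^+ g.+1 * F).
Proof.
move: F; apply: pm_ind => [c F G JF JG||m].
- by rewrite mulrDr -scalerAr; exact: pm_J_linear.
- by rewrite mulr0; exact: pm_J0.
rewrite x_exp_mono; apply: pm_J_mono.
by rewrite wdeg_ucm_iter muln1 ltnS leq_addr.
Qed.

(** Writing F = D^(g+1) G, modulo J its image is x_1^(g+1) times S G, which has only terms of degree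
    above g. *)
Lemma pm_S_J F : J F -> J (pm_S F).
Proof.
move=> /(_ g.+1)[G ->].
rewrite -[pm_S _](subKr (x1 ^+ g.+1 * pm_S G)).
by apply: pm_J_sub; [exact: pm_J_x1_exp | exact: pm_S_iter_D].
Qed.

(** Applying S to the r-th term of P_(-l-n)(y) gives a multiple of P_(n+r)(D^r y), and [dp_P]
    expands x_1^[n] y in the same elements, so the comparison is term by term. If the exponent of
    x_1 in a term is negative, that term is 0 while its partner in [dp_P] lies in J. *)
Lemma pm_S_S (n d k N : nat) y : x1_free d k N y ->
  J (pm_S (pm_S (dp n * y)) - (-1) ^+ (g + d + k) *: (dp n * y)).
Proof.
move=> yf; have [_ _ yN] := yf; have hy := x1_free_h yf.
rewrite (pm_S_dp _ yf) (dp_P n yN) (linear_scale lS) (linear_bigsum lS).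
rewrite !scaler_sumr -sumrB; apply: pm_J_sum => r _.
have yfr := x1_free_iter r yf; have [_ _ yrN] := yfr.
rewrite (linear_scale lS).
case aE: (g%:Z - d%:Z - k%:Z - n%:Z + r%:Z) => [a|a].
  rewrite (pm_S_dp _ yfr).
  rewrite (_ : g%:Z - (d%:Z - r%:Z) - (k%:Z - r%:Z) - a%:Z = n%:Z + r%:Z); last by lia.
  suff -> : forall z : A, (-1) ^+ n *: (r`!%:R^-1 *: ((-1) ^+ a *: z))
     - (-1) ^+ (g + d + k) *: (((-1) ^+ r / r`!%:R) *: z) = 0 by exact: pm_J0.
  move=> z; rewrite !scalerA -scalerBl.
  have -> : (-1) ^+ (g + d + k) = (-1) ^+ (n + a + r) :> rat.
    rewrite -signr_odd -[RHS]signr_odd; congr (_ ^+ nat_of_bool _).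
    (* The signs match because n + a and g + d + k + r have the same parity. *)
    have : (n + a + d + k = g + r)%N by lia.
    move/(congr1 odd); rewrite !oddD.
    by case: (odd n); case: (odd a); case: (odd d); case: (odd k); case: (odd g); case: (odd r).
  rewrite !exprD; set s := (-1) ^+ r; have s2 : s * s = 1 by rewrite -expr2 sqrr_sign.
  suff -> : (-1) ^+ n / r`!%:R * (-1) ^+ a
     - (-1) ^+ n * (-1) ^+ a * s * (s / r`!%:R) = 0 :> rat by exact: scale0r.
  by rewrite !mulrA -[_ * s * s]mulrA s2 mulr1 [_ / _ * _]mulrAC subrr.
rewrite mul0r (linear_0 lS) !scaler0 sub0r -scaleN1r scalerA; apply: pm_JZ; apply: pm_JZ.
by apply: (pm_J_P (x1_free_h yfr) yrN); lia.
Qed.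

End Fourier.

(** * The action of S as an explicit sum over set partitions *)

Section SetPartitions.
Variable (A : polyModel) (g : nat).
Implicit Types (F G : A).
Local Notation mono := (@pm_mono A).
Local Notation v i := (pm_x A i.+1).
Local Notation D := (@pm_D A g).
Local Notation E := (@pm_E A g).

Let lD : linear D := @pm_D_linear A g.

(** For a = 0 the constant -g in [D, x_1] = h would spoil the Leibniz rule; the block variables have
    index above 1, so a > 0 suffices. *)
Lemma pm_E_derivation a F G : (0 < a)%N -> E a (F * G) = E a F * G + F * E a G.
Proof.
move=> a0; have lE := @pm_E_linear A g a.
have Ea1 : E a 1 = 0 by rewrite pm_E1 (gtn_eqF a0) muln0 scale0r oppr0.
suff : forall F, E a (F * G) - (E a F * G + F * E a G) = 0.
  by move=> /(_ F)/eqP; rewrite subr_eq0 => /eqP.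
apply: linear_comm_eq0 => [c F1 F2||b F1].
- rewrite mulrDl -scalerAl !lE mulrDl mulrDl -!scalerAl !scale_in_alg; ring.
- by rewrite Ea1 !mul1r mul0r add0r subrr.
have Ev H : E a (v b * H) = v b * E a H + 'C(a.+1 + b.+1, a.+1)%:R *: (v (a + b) * H).
  by rewrite -(pm_E_comm g) /lie_bracket addrC subrK.
rewrite /lie_bracket -mulrA !Ev !scale_in_alg; ring.
Qed.

Section Monomial.
Variables (k : nat) (ns : 'I_k -> nat).
Hypothesis ns_gt1 : forall i, (1 < ns i)%N.
Implicit Types (I J K L : {set 'I_k}).

Definition block_term I : A := bcoef ns I *: pm_x A (dcoef ns I).

Local Notation Psi := (part_sum block_term).

Lemma dcoefE I : I != finset.set0 -> exists2 a, (0 < a)%N & dcoef ns I = a.+1.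
Proof.
rewrite -card_gt0 => I0; have := block_sum_ge ns_gt1 I; rewrite /dcoef.
move: #|I| (\sum_(i in I) _)%N I0 => c s c0 cs; exists (s - c)%N; lia.
Qed.

Lemma D_part_sum M K : D (Psi M.+1 K) = (#|K|%:R - M%:R) * Psi M K.
Proof.
have Ea1 a : (0 < a)%N -> E a 1 = 0.
  by move=> a0; rewrite pm_E1 (gtn_eqF a0) muln0 scale0r oppr0.
apply: (@part_sum_flow _ _ _ D (fun I F => bcoef ns I *: E (dcoef ns I).-1 F)).
- exact: linear_add.
- exact: linear_0.
- exact: pm_D1.
- move=> I F /dcoefE[a a0 dE]; rewrite /block_term dE /=.
  rewrite -!scalerAl (linear_scale lD) -scalerDr; congr (_ *: _).
  by rewrite /pm_E /lie_bracket [RHS]addrC subrK.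
- move=> I /dcoefE[a a0 ->] /=; have lE := @pm_E_linear A g a; split.
  + by move=> F G; rewrite (linear_add lE) scalerDr.
  + by move=> F G; rewrite pm_E_derivation // scalerDr -scalerAl -scalerAr.
  + by rewrite (linear_0 lE) scaler0.
  + by rewrite Ea1 // scaler0.
move=> L x0 xL.
transitivity ((\sum_(I : {set 'I_k} | [&& I \subset L, x0 \in I & I != L])
    bcoef ns I * bcoef ns (L :\: I)%SET *
    'C(dcoef ns I + dcoef ns (L :\: I)%SET, dcoef ns I)%:R) *: pm_x A (dcoef ns L)).
  rewrite scaler_suml; apply: eq_bigr => I /and3P[IL xI IL'].
  have I0 : I != finset.set0 by apply/set0Pn; exists x0.
  have J0 : (L :\: I)%SET != finset.set0.
    by rewrite finset.setD_eq0; apply: contra IL' => LI; rewrite finset.eqEsubset IL.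
  have := dcoefU ns_gt1 I0 IL IL'.
  rewrite /block_term; have [a a0 ->] := dcoefE I0; have [b b0 ->] := dcoefE J0.
  rewrite /= addSn addnS => -[<-].
  rewrite (linear_scale (@pm_E_linear A g a)) !scalerA -mulrA -!scalerA; congr (_ *: (_ *: _)).
  have := @pm_E_comm A g a b 1; rewrite /lie_bracket Ea1 // mulr0 subr0 !mulr1.
  by move=> ->; rewrite addSn addnS.
rewrite (bcoef_split ns_gt1 xL) /block_term -scalerA [LHS]scale_in_alg.
by rewrite rmorphB rmorph1 rmorph_nat.
Qed.

Let y : A := \prod_(i < k) pm_x A (ns i).

Lemma part_sum_singletons : Psi k [set: 'I_k]%SET = y.
Proof.
have -> : Psi k [set: 'I_k]%SET = Psi #|[set: 'I_k]%SET| [set: 'I_k]%SET.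
  by rewrite cardsT card_ord.
rewrite part_sum_max; apply: eq_big => [i|i _]; first by rewrite finset.in_setT.
rewrite /block_term /bcoef /dcoef !big_set1 cards1 divff ?facR_neq0 // scale1r.
by rewrite subnK // ltnW.
Qed.

(** Start from the partition into singletons, where b = 1 and d is the index itself. Passing from k
    - r to k - r - 1 blocks gives the factor k - (k - r - 1) = r + 1, hence r! in total. *)
Lemma iter_D_part_sum r : (r <= k)%N ->
  iter r D y = r`!%:R *: Psi (k - r)%N [set: 'I_k]%SET.
Proof.
elim: r => [_|r IH rk]; first by rewrite subn0 part_sum_singletons scale1r.
rewrite iterS IH ?(ltnW rk) // (linear_scale lD).
rewrite (_ : (k - r = (k - r.+1).+1)%N); last by lia.
rewrite D_part_sum cardsT card_ord -natrB ?leq_subr // subKn //.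
by rewrite mulr_natl -scaler_nat scalerA factS natrM mulrC.
Qed.

Definition pm_Srhs (n : nat) : A :=
  \sum_(P : {set {set 'I_k}} | finset.partition P [set: 'I_k]%SET)
    (\prod_(I in P) bcoef ns I) *:
      (pm_dp A (g%:Z - n%:Z - #|P|%:Z - (\sum_i ns i)%N%:Z)
       * \prod_(I in P) pm_x A (dcoef ns I)).

Lemma pm_P_Srhs (n : nat) :
  pm_P g k.+1 (g%:Z - (\sum_i ns i)%N%:Z - k%:Z - n%:Z) y = pm_Srhs n.
Proof.
set s := (\sum_i ns i)%N.
transitivity (\sum_(M < k.+1)
    pm_dp A (g%:Z - n%:Z - M%:Z - s%:Z) * Psi M [set: 'I_k]%SET).
  (* The power r of D corresponds to M = k - r blocks, hence the reversal of the summation. *)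
  rewrite /pm_P big_mkord [RHS](reindex_inj rev_ord_inj); apply: eq_bigr => r _ /=.
  have rk : (r <= k)%N by rewrite -ltnS.
  rewrite iter_D_part_sum // -scalerAr scalerA mulVf ?facR_neq0 // scale1r subSS.
  by congr (pm_dp A _ * _); move: s => s; lia.
rewrite /pm_Srhs (partition_big (fun P : {set {set 'I_k}} => inord #|P| : 'I_k.+1) predT) //=.
apply: eq_bigr => M _; rewrite /part_sum mulr_sumr.
apply: eq_big => P.
  have [PT|//] := boolP (finset.partition P _); rewrite /= -val_eqE /= inordK //.
  by rewrite ltnS; have := card_partition_le PT; rewrite cardsT card_ord.
case/andP => _ /eqP->; rewrite scaler_prod -scalerAr.
by rewrite /s.
Qed.

Lemma mono_xprod (I : Type) (r : seq I) (f : I -> nat) : (forall i, (1 < f i)%N) ->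
  exists m, [/\ \prod_(i <- r) pm_x A (f i) = mono m, m 0%N = 0%N,
    wdeg m = (\sum_(i <- r) f i)%N & mdeg m = size r].
Proof.
move=> f1; elim: r => [|i r [m [mE m0 wm dm]]].
  exists 1%M; rewrite !big_nil pm_mono1; split=> //; first by rewrite cm1.
    exact: nwt1.
  by rewrite mdeg1.
exists (ucm (f i).-1 * m)%M; rewrite !big_cons mE.
have fi := f1 i; have fE : f i = (f i).-2.+2 by lia.
split.
- by rewrite /pm_x pm_monoM.
- by rewrite cmM ucmE m0 fE.
- by rewrite wdegM wdegU wm prednK // ltnW.
- by rewrite mdegM mdegU dm.
Qed.

Lemma x1_free_xprod : x1_free g (\sum_i ns i)%N%:Z k%:Z k.+1 y.
Proof.
have [m [mE m0 wm dm]] := mono_xprod (index_enum 'I_k) ns_gt1.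
have sk : size (index_enum 'I_k) = k by rewrite -[index_enum _]enumT size_enum_ord.
by have := x1_free_mono A g m0; rewrite /y mE wm dm sk.
Qed.

Lemma pm_S_Srhs (n : nat) :
  (-1) ^+ n *: pm_S g (pm_dp A n * y) = pm_Srhs n.
Proof.
rewrite (pm_S_dp _ x1_free_xprod) scalerA -expr2 sqrr_sign scale1r.
exact: pm_P_Srhs.
Qed.

End Monomial.
End SetPartitions.

(** * The quotient *)

Section Bundle.
Variables (V W : lmodType rat) (T : V -> W) (lT : linear T).
(** The operators are handled as plain functions with a proof of linearity; this alias keeps that
    proof as an argument, so that a bundled linear map can be declared from it. *)
Definition bundle of linear T := T.
HB.instance Definition _ := GRing.isLinear.Build rat V W *:%R (bundle lT) lT.
Definition linear_bundle : {linear V -> W} := bundle lT.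
End Bundle.

Section Quotient.
Variables (V : lmodType rat) (B : set V).
Local Notation Q := (lquot B).

(** Computed on a chosen representative; for T linear and preserving the span, [lquot_mapE] shows
    that the choice does not matter. *)
Definition lquot_map (T : V -> V) (q : Q) : Q := \pi_Q (T (repr q)).

Lemma lquot_ind (Pr : Q -> Prop) : (forall u, Pr (\pi_Q u)) -> forall q, Pr q.
Proof. by move=> P q; rewrite -[q]reprK. Qed.

Lemma lquot_pi_eq u v : lspan B (u - v) -> \pi_Q u = \pi_Q v.
Proof. by move/lquot_eqP. Qed.

Lemma lquot_scale_pi a u : a *: \pi_Q u = \pi_Q (a *: u).
Proof. by rewrite lquot_piZ. Qed.

Lemma lquot_piN u : - \pi_Q u = \pi_Q (- u).
Proof. by rewrite -(scaleN1r (\pi_Q u)) lquot_scale_pi scaleN1r. Qed.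

Lemma lquot_repr u : lspan B (repr (\pi_Q u) - u).
Proof. by apply/lquot_eqP; rewrite reprK. Qed.

Variable T : V -> V.
Hypotheses (lT : linear T) (BT : forall u, lspan B u -> lspan B (T u)).

Lemma lquot_mapE u : lquot_map T (\pi_Q u) = \pi_Q (T u).
Proof.
by apply: lquot_pi_eq; rewrite -(linear_sub lT); apply: BT; exact: lquot_repr.
Qed.

Lemma lquot_map_linear : linear (lquot_map T).
Proof.
move=> a; elim/lquot_ind => u; elim/lquot_ind => v.
have -> : a *: \pi_Q u + \pi_Q v = \pi_Q (a *: u + v) by rewrite lquot_piD lquot_piZ.
by rewrite !lquot_mapE lT lquot_piD lquot_piZ.
Qed.

End Quotient.

Arguments lquot_map {V} B T.

Section Main.
Variable (A : polyModel) (g : nat) (B : set A).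
Hypothesis BJ : forall F, lspan B F <-> pm_J g F.
Implicit Types (F G : A).
Local Notation x1 := (pm_x A 1).
Local Notation D := (@pm_D A g).
Local Notation h := (@pm_h A g).
Local Notation S := (@pm_S A g).
Local Notation Q := (lquot B).
Local Notation e := (fun F : A => x1 * F).
Local Notation f := (fun F : A => - D F).

Let lD : linear D := @pm_D_linear A g.
Let lh : linear h := @pm_h_linear A g.
Let lS : linear S := @pm_S_linear A g.
Let le : linear e := @mul_linear A x1.

Let lf : linear f.
Proof. by move=> a F G; rewrite lD opprD scalerN. Qed.

Lemma pm_J_h F : pm_J g F -> pm_J g (h F).
Proof.
move=> JF; have -> : h F = D (x1 * F) - x1 * D F by rewrite pm_D_x1 addrC addKr.
apply: pm_J_sub; first by apply: pm_J_D; exact: pm_J_mul.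
by apply: pm_J_mul; exact: pm_J_D.
Qed.

Lemma span_e F : lspan B F -> lspan B (e F).
Proof. by move/BJ => JF; apply/BJ; exact: pm_J_mul. Qed.

Lemma span_f F : lspan B F -> lspan B (f F).
Proof. by move/BJ => JF; apply/BJ; rewrite -scaleN1r; apply: pm_JZ; exact: pm_J_D. Qed.

Lemma span_h F : lspan B F -> lspan B (h F).
Proof. by move/BJ => JF; apply/BJ; exact: pm_J_h. Qed.

Lemma span_S F : lspan B F -> lspan B (S F).
Proof. by move/BJ => JF; apply/BJ; exact: pm_S_J. Qed.

Lemma span_bigcap :
  lspan B = \bigcap_(n in [set n : nat | (1 <= n)%N]) range (iter n D).
Proof.
rewrite eqEsubset; split=> F.
  by move=> /BJ JF n _; have [G ->] := JF n; exists G.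
move=> FI; apply/BJ => n; have [|G _ <-] := FI n.+1; first by [].
by exists (D G); rewrite -iterSr.
Qed.

Lemma sl2_poly : sl2_rep e f h.
Proof.
split; first by split.
split=> F; rewrite /lie_bracket /=.
- by rewrite pm_D_x1 mulrN; ring.
- by rewrite pm_h_x1 addrC addKr.
- rewrite (linear_opp lh) pm_h_D !scale_in_alg rmorphN rmorph_nat; ring.
Qed.

Lemma sl2_quot : sl2_rep (lquot_map B e) (lquot_map B f) (lquot_map B h).
Proof.
have [_ [ef he hf]] := sl2_poly.
have me := lquot_mapE le span_e; have mf := lquot_mapE lf span_f.
have mh := lquot_mapE lh span_h.
have pB u v : \pi_Q u - \pi_Q v = \pi_Q (u - v).
  by rewrite lquot_piN -lquot_piD.
split.
  by split; [exact: lquot_map_linear le span_e | exact: lquot_map_linear lf span_f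
            | exact: lquot_map_linear lh span_h].
split; elim/lquot_ind => u; rewrite /lie_bracket !(me, mf, mh) pB.
- by congr (\pi_Q _); exact: ef.
- by rewrite lquot_scale_pi -he.
- by rewrite lquot_scale_pi -hf.
Qed.

(** S^2 acts by a sign that depends on the monomial, so it is not a global scalar, but its square is
    1 modulo J. Hence the inverse of S on the quotient is S^3. *)
Lemma pm_S4 F : pm_J g (S (S (S (S F))) - F).
Proof.
move: F; apply: dp_ind => [c F G SF SG||n d k N y yf].
- rewrite !lS.
  have -> : c *: S (S (S (S F))) + S (S (S (S G))) - (c *: F + G)
    = c *: (S (S (S (S F))) - F) + (S (S (S (S G))) - G).
    by rewrite scalerBr opprD addrACA.
  exact: pm_J_linear.
- by rewrite !(linear_0 lS) subr0; exact: pm_J0.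
set F := _ * y; pose s : rat := (-1) ^+ (g + d + k).
have JF : pm_J g (S (S F) - s *: F) := pm_S_S n yf.
have s2 : s * s = 1 by rewrite -expr2 sqrr_sign.
have -> : S (S (S (S F))) - F = S (S (S (S F) - s *: F)) + s *: (S (S F) - s *: F).
  rewrite !(linear_sub lS) !(linear_scale lS) scalerBr scalerA s2 scale1r.
  by rewrite addrA subrK.
by apply: pm_JD; [do 2!apply: pm_S_J | apply: pm_JZ].
Qed.

Lemma mul_quot :
  exists mul : Q -> Q -> Q,
    [/\ associative mul, commutative mul, left_id (\pi_Q 1) mul,
        left_distributive mul +%R
      & forall F G : A, \pi_Q (F * G) = mul (\pi_Q F) (\pi_Q G)].
Proof.
pose mul (a b : Q) : Q := \pi_Q (repr a * repr b).
have mulE F G : mul (\pi_Q F) (\pi_Q G) = \pi_Q (F * G).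
  apply: lquot_pi_eq; apply/BJ.
  set F' := repr _; set G' := repr _.
  have -> : F' * G' - F * G = G' * (F' - F) + F * (G' - G) by ring.
  by apply: pm_JD; apply: pm_J_mul; apply/BJ; exact: lquot_repr.
exists mul; split.
- elim/lquot_ind => u; elim/lquot_ind => v; elim/lquot_ind => w.
  by rewrite !mulE mulrA.
- by move=> a b; rewrite /mul mulrC.
- by elim/lquot_ind => u; rewrite mulE mul1r.
- elim/lquot_ind => u; elim/lquot_ind => v; elim/lquot_ind => w.
  by rewrite -lquot_piD !mulE mulrDl lquot_piD.
- by move=> F G; rewrite mulE.
Qed.

(** The theorem over an abstract polynomial model, for any B whose span is J; the passage to [Qx] is
    then a rewriting of the operators followed by conversion. *)
Lemma tautological_main :
  [/\ lspan B = \bigcap_(n in [set n : nat | (1 <= n)%N]) range (iter n D),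
      [/\ lspan B 0, (forall F G, lspan B F -> lspan B G -> lspan B (F + G))
        & forall F G, lspan B G -> lspan B (F * G)] /\
      (exists mul : Q -> Q -> Q,
        [/\ associative mul, commutative mul, left_id (\pi_Q 1) mul,
            left_distributive mul +%R
          & forall F G : A, \pi_Q (F * G) = mul (\pi_Q F) (\pi_Q G)])
    & exists Sx : {linear A -> A}, exists S : {linear Q -> Q},
      [/\ forall (n k : nat) (ns : 'I_k -> nat), (forall i, (1 < ns i)%N) ->
            (-1) ^+ n *: Sx (pm_dp A n%:Z * \prod_(i < k) pm_x A (ns i))
            = pm_Srhs A g ns n,
          [/\ forall F, lspan B F -> lspan B (Sx F),
              forall F, S (\pi_Q F) = \pi_Q (Sx F)
            & forall (n k : nat) (ns : 'I_k -> nat), (forall i, (1 < ns i)%N) ->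
                (-1) ^+ n *: S (\pi_Q (pm_dp A n%:Z * \prod_(i < k) pm_x A (ns i)))
                = \pi_Q (pm_Srhs A g ns n)],
          forall (n k : nat) (ns : 'I_k -> nat), (forall i, (1 < ns i)%N) ->
            let p := \pi_Q (x1 ^+ n * \prod_(i < k) pm_x A (ns i)) in
            S (S p) = (-1) ^+ (g + k + \sum_i ns i)%N *: p
        & [/\ sl2_rep e f h,
              [/\ forall F, lspan B F -> lspan B (e F),
                  forall F, lspan B F -> lspan B (f F)
                & forall F, lspan B F -> lspan B (h F)]
            & exists e' f' h' : Q -> Q,
              [/\ [/\ forall F, e' (\pi_Q F) = \pi_Q (e F),
                      forall F, f' (\pi_Q F) = \pi_Q (f F)
                    & forall F, h' (\pi_Q F) = \pi_Q (h F)],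
                  sl2_rep e' f' h'
                & exists Sinv : Q -> Q,
                  [/\ cancel S Sinv, cancel Sinv S
                    & forall a, [/\ S (e' (Sinv a)) = - f' a,
                                    S (f' (Sinv a)) = - e' a
                                  & S (h' (Sinv a)) = - h' a]]]]]].
Proof.
split; first exact: span_bigcap.
  split; last exact: mul_quot.
  split; [exact: lspan0 | by move=> F G; exact: lspanD|].
  by move=> F G /BJ JG; apply/BJ; exact: pm_J_mul.
have lS' := lquot_map_linear lS span_S; have mS := lquot_mapE lS span_S.
have me := lquot_mapE le span_e; have mf := lquot_mapE lf span_f.
have mh := lquot_mapE lh span_h.
have piZ := @lquot_scale_pi A B; have piN := @lquot_piN A B.
exists (linear_bundle lS), (linear_bundle lS').
rewrite -[linear_bundle lS : A -> A]/S -[linear_bundle lS' : Q -> Q]/(lquot_map B S).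
split.
- by move=> n k ns ns1; exact: pm_S_Srhs.
- split; [exact: span_S | exact: mS |].
  by move=> n k ns ns1; rewrite mS piZ; congr (\pi_Q _); exact: pm_S_Srhs.
- move=> n k ns ns1 /=; set p := _ ^+ n * _.
  have pE : p = n`!%:R *: (pm_dp A n * \prod_(i < k) pm_x A (ns i)).
    by rewrite /p -scalerAl scalerA mulfV ?scale1r // facR_neq0.
  rewrite -[LHS]/(lquot_map B S (lquot_map B S (\pi_Q p))) (mS p) (mS (S p)) piZ.
  apply: lquot_pi_eq; apply/BJ.
  have := pm_S_S n (x1_free_xprod A g ns1).
  rewrite addnAC pE; set z := _ * _; set c := (-1) ^+ _ => Jz.
  have -> : S (S (n`!%:R *: z)) - c *: (n`!%:R *: z) = n`!%:R *: (S (S z) - c *: z).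
    by rewrite !(linear_scale lS) scalerBr !scalerA (mulrC c).
  exact: pm_JZ.
split; [exact: sl2_poly | by split; [exact: span_e|exact: span_f|exact: span_h]|].
exists (lquot_map B e), (lquot_map B f), (lquot_map B h); split=> //.
  exact: sl2_quot.
have S4 a : lquot_map B S (lquot_map B S (lquot_map B S (lquot_map B S a))) = a.
  elim/lquot_ind: a => u.
  rewrite (mS u) (mS (S u)) (mS (S (S u))) (mS (S (S (S u)))).
  apply: lquot_pi_eq; apply/BJ.
  exact: pm_S4.
exists (fun a => lquot_map B S (lquot_map B S (lquot_map B S a))); split.
- by move=> a; exact: S4.
- by move=> a; exact: S4.
(* Here b is the preimage of a under S; with a = S b the relations no longer mention the inverse. *)
move=> a; set b := lquot_map B S (lquot_map B S _).
have -> : a = lquot_map B S b by rewrite S4.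
elim/lquot_ind: b => u; rewrite (mS u) (me u) (mf u) (mh u).
rewrite (me (S u)) (mf (S u)) (mh (S u)) (mS (x1 * u)) (mS (- D u)) (mS (h u)) !piN.
split.
- by congr (\pi_Q _); rewrite pm_S_x1 opprK.
- apply: lquot_pi_eq; apply/BJ; rewrite (linear_opp lS) opprK addrC.
  exact: pm_S_D.
- by congr (\pi_Q _); exact: pm_S_h.
Qed.

End Main.

(** * Transfer to the polynomial ring itself *)

Section QxModel.

Let Qx_mono (m : {cmonom nat}) : Qx := << m >>.

Lemma Qx_monoM m n : Qx_mono m * Qx_mono n = Qx_mono (mmul m n).
Proof. by rewrite /Qx_mono malgM_def fgmulUU mulr1. Qed.

Lemma Qx_monoZ (a : rat) m : << a *g m >> = a *: Qx_mono m.
Proof. by rewrite /Qx_mono -mul_malgC malgM_def fgmulUU mulr1 mul1m. Qed.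

Lemma Qx_coefP m (a : rat) (F G : Qx) : (a *: F + G)@_m = a * F@_m + G@_m.
Proof. by rewrite mcoeffD mcoeffZ. Qed.

Lemma Qx_coef_mono m n : (Qx_mono n)@_m = (n == m)%:R.
Proof. exact: mcoeffU. Qed.

Lemma Qx_suppE (F : Qx) m : (m \in msupp F) = (F@_m != 0).
Proof. by rewrite mcoeff_neq0. Qed.

Lemma Qx_expand (F : Qx) : F = \sum_(m <- msupp F) F@_m *: Qx_mono m.
Proof. by rewrite {1}(monalgE F); apply: eq_bigr => m _; exact: Qx_monoZ. Qed.

Definition Qx_model : polyModel := @PolyModel Qx Qx_mono
  (fun m F => F@_m) (fun F => msupp F)
  erefl Qx_monoM Qx_coefP Qx_coef_mono Qx_suppE Qx_expand.

Lemma pderivE : pderiv = @pm_pd Qx_model.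
Proof.
apply/funext => i; apply/funext => F; apply: eq_bigr => m _.
by rewrite Qx_monoZ scalerA mulr_natr.
Qed.

Lemma opDE g : opD g = @pm_D Qx_model g.
Proof. by apply/funext => F; rewrite /opD pderivE. Qed.

Lemma op_hE g : op_h g = @pm_h Qx_model g.
Proof. by apply/funext => F; rewrite /op_h pderivE. Qed.

Lemma Ig_gensE g : Ig_gens g = @pm_gens Qx_model g.
Proof. by rewrite /Ig_gens opDE. Qed.

End QxModel.

Theorem theorem0p5 (g : nat) (hg : (2 <= g)%N) :
  [/\ Ig g = \bigcap_(n in [set n : nat | (1 <= n)%N]) range (iter n (opD g)),
      is_ideal (Ig g) /\
      (exists mul : RJac g -> RJac g -> RJac g,
        [/\ associative mul, commutative mul, left_id (\pi_(RJac g) 1) mul,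
            left_distributive mul +%R
          & forall F G : Qx,
              \pi_(RJac g) (F * G) = mul (\pi_(RJac g) F) (\pi_(RJac g) G)])
    & exists Sx : {linear Qx -> Qx}, exists S : {linear RJac g -> RJac g},
      [/\ forall (n k : nat) (ns : 'I_k -> nat), (forall i, (1 < ns i)%N) ->
            (-1) ^+ n *: Sx (divpow 'x_1 n%:Z * \prod_(i < k) 'x_(ns i))
            = Srhs ns g n,
          [/\ preserves (Ig g) Sx, induces Sx S
            & forall (n k : nat) (ns : 'I_k -> nat), (forall i, (1 < ns i)%N) ->
                (-1) ^+ n *:
                  S (\pi_(RJac g) (divpow 'x_1 n%:Z * \prod_(i < k) 'x_(ns i)))
                = \pi_(RJac g) (Srhs ns g n)],
          forall (n k : nat) (ns : 'I_k -> nat), (forall i, (1 < ns i)%N) ->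
            let p := \pi_(RJac g) ('x_1 ^+ n * \prod_(i < k) 'x_(ns i)) in
            S (S p) = (-1) ^+ (g + k + \sum_i ns i)%N *: p
        & [/\ sl2_rep op_e (op_f g) (op_h g),
              [/\ preserves (Ig g) op_e, preserves (Ig g) (op_f g)
                & preserves (Ig g) (op_h g)]
            & exists e f h : RJac g -> RJac g,
              [/\ [/\ induces op_e e, induces (op_f g) f & induces (op_h g) h],
                  sl2_rep e f h
                & exists Sinv : RJac g -> RJac g,
                  [/\ cancel S Sinv, cancel Sinv S
                    & forall a, [/\ S (e (Sinv a)) = - f a,
                                    S (f (Sinv a)) = - e a
                                  & S (h (Sinv a)) = - h a]]]]]].
Proof.
have BJ (F : Qx_model) : lspan (Ig_gens g) F <-> pm_J g F.
  by rewrite Ig_gensE; exact: (@lspan_gensE Qx_model g F).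
have := tautological_main BJ.
rewrite -op_hE -opDE.
by [].
Qed.
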